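(* For $1\le j\le N$ let $\ell_j:\mathbb{R}^d\to\mathbb{R}^{d_j}$ be a surjective linear transformation and let $p_j\in[1,\infty]$. Then there exists $C<\infty$ such that $$\int_{\mathbb{R}^d}\prod_{j=1}^N f_j(\ell_j(y))\,dy\le C\prod_{j=1}^N\|f_j\|_{\ell^{p_j}(L^\infty)(\mathbb{R}^{d_j})}\quad\text{for all nonnegative (measurable) functions } f_j \text{ on } \mathbb{R}^{d_j}$$ if and only if for every linear subspace $V\subset\mathbb{R}^d$, $$\dim(V)\le\sum_{j=1}^N p_j^{-1}\dim(\ell_j(V)).$$
   Context: In $\mathbb{R}^d$, for each $n\in\mathbb{Z}^d$ define $Q_n=\{x\in\mathbb{R}^d:|x-n|\le\sqrt d\}$. The space $\ell^p(L^\infty)(\mathbb{R}^d)$ is the space of all $f\in L^\infty(\mathbb{R}^d)$ for which the norm $\|f\|_{\ell^p(L^\infty)(\mathbb{R}^d)}=\big(\sum_{n\in\mathbb{Z}^d}\|f\|_{L^\infty(Q_n)}^p\big)^{1/p}$ is finite (with the supremum over $n$ of $\|f\|_{L^\infty(Q_n)}$ when $p=\infty$); the same definition is used on each $\mathbb{R}^{d_j}$. The convention $\infty^{-1}=0$ is used. *)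

(* Defs.v *)
From HB Require Import structures.
From mathcomp Require Import all_boot all_order all_algebra.
From mathcomp Require Import all_classical all_reals all_analysis.

Set Implicit Arguments.
Unset Strict Implicit.
Unset Printing Implicit Defensive.

Import Order.TTheory GRing.Theory Num.Theory.
Import numFieldNormedType.Exports.

Local Open Scope classical_set_scope.
Local Open Scope ring_scope.

(* R^n is 'rV[R]_n.  The library has no Lebesgue measure on 'rV[R]_n, so it is
   built here as the completion of the n-fold product of the one-dimensional
   Lebesgue measure. *)

Section borel_rV.
Context {R : realType}.

Definition coord_sets (n : nat) : set (set 'rV[R]_n) :=
  \big[setU/set0]_(i < n)
    preimage_set_system [set: 'rV[R]_n] (fun x => x ord0 i)
      (measurable : set (set (measurableTypeR R))).

Let coord_setsP (n : nat) (B : set 'rV[R]_n) : coord_sets B ->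
  exists i, preimage_set_system [set: 'rV[R]_n] (fun x => x ord0 i)
    (measurable : set (set (measurableTypeR R))) B.
Proof. by rewrite /coord_sets -bigcup_seq/= => -[i _ iB]; exists i. Qed.

(* 'rV[R]_n with the Borel sigma-algebra, generated by the n coordinates *)
Definition borel_rV (n : nat) := g_sigma_algebraType (@coord_sets n).

HB.instance Definition _ (n : nat) := Measurable.on (borel_rV n).

Lemma measurable_coord (n : nat) (i : 'I_n) :
  measurable_fun [set: borel_rV n]
    (fun x : borel_rV n => (x : 'rV[R]_n) ord0 i : measurableTypeR R).
Proof.
move=> _ Y mY; rewrite setTI; apply: sub_sigma_algebra => /=.
rewrite /coord_sets -bigcup_seq/=; exists i => /=; first by rewrite mem_index_enum.
by exists Y => //; rewrite setTI.
Qed.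

Lemma measurable_fun_coord d (T : measurableType d) (n : nat)
    (f : T -> borel_rV n) :
  (forall i, measurable_fun [set: T]
     (fun t => (f t : 'rV[R]_n) ord0 i : measurableTypeR R)) ->
  measurable_fun [set: T] f.
Proof.
move=> mf; apply: (@measurability _ _ _ _ setT f (@coord_sets n)) => //.
move=> _ [B /coord_setsP[i [Y mY <-]] <-].
by have := mf i measurableT _ mY; rewrite !setTI.
Qed.

Definition row_cons (n : nat) (p : measurableTypeR R * borel_rV n) :
    borel_rV n.+1 :=
  row_mx (p.1 : R)%:M (p.2 : 'rV[R]_n) : 'rV[R]_(1 + n).

Lemma measurable_row_cons (n : nat) : measurable_fun [set: _] (@row_cons n).
Proof.
apply: measurable_fun_coord => i.
have [j ->|j ->] := @split_ordP 1 n i.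
  rewrite (_ : (fun _ => _) = fst); first exact: measurable_fst.
  apply/funext => p /=; rewrite /row_cons (@row_mxEl R 1 1 n) (ord1 j).
  by rewrite mxE eqxx mulr1n.
rewrite (_ : (fun _ => _) = (fun x : borel_rV n => (x : 'rV[R]_n) ord0 j) \o snd).
  exact: measurableT_comp (measurable_coord j) measurable_snd.
by apply/funext => p /=; rewrite /row_cons (@row_mxEr R 1 1 n).
Qed.

End borel_rV.

Section row_cons_measure.
Context {R : realType} (n : nat).
Variable mu : {sigma_finite_measure set (@borel_rV R n) -> \bar R}.

Let m : {measure set (measurableTypeR R * borel_rV n) -> \bar R} :=
  (@lebesgue_measure R \x mu)%E.

Definition row_cons_measure : set (@borel_rV R n.+1) -> \bar R :=
  pushforward (@lebesgue_measure R \x mu)%E (@row_cons R n).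

Let mpre (A : set (@borel_rV R n.+1)) :
  measurable A -> measurable (@row_cons R n @^-1` A).
Proof.
by move=> mA; rewrite -[X in measurable X]setTI; exact: measurable_row_cons.
Qed.

Let row_cons_measure0 : row_cons_measure set0 = 0%E.
Proof. by rewrite /row_cons_measure /pushforward preimage_set0 (measure0 m). Qed.

Let row_cons_measure_ge0 A : (0 <= row_cons_measure A)%E.
Proof. exact: (measure_ge0 m). Qed.

Let row_cons_measure_sigma_additive : semi_sigma_additive row_cons_measure.
Proof.
move=> F mF tF mUF; rewrite /row_cons_measure /pushforward preimage_bigcup.
apply: (@measure_semi_sigma_additive _ _ _ m).
- by move=> k; exact: mpre.
- apply/trivIsetP => /= i j _ _ ij; rewrite -preimage_setI.
  by move/trivIsetP : tF => /(_ _ _ _ _ ij) ->//; rewrite preimage_set0.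
- by rewrite -preimage_bigcup; exact: mpre.
Qed.

HB.instance Definition _ := isMeasure.Build _ _ _ row_cons_measure
  row_cons_measure0 row_cons_measure_ge0 row_cons_measure_sigma_additive.

Let row_cons_measure_sigma_finite : sigma_finite [set: borel_rV n.+1] row_cons_measure.
Proof.
have /sigma_finiteP[F [TF ndF Foo]] := sigma_finiteT (@lebesgue_measure R).
have /sigma_finiteP[G [TG ndG Goo]] := sigma_finiteT mu.
pose hd (x : borel_rV n.+1) : measurableTypeR R := (x : 'rV[R]_(1 + n)) ord0 (lshift n ord0).
pose tl (x : borel_rV n.+1) : borel_rV n := rsubmx (x : 'rV[R]_(1 + n)).
have mhd : measurable_fun [set: borel_rV n.+1] hd by exact: measurable_coord.
have mtl : measurable_fun [set: borel_rV n.+1] tl.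
  apply: measurable_fun_coord => i.
  rewrite (_ : (fun _ => _) =
    (fun x : borel_rV n.+1 => (x : 'rV[R]_n.+1) ord0 (rshift 1 i))); last first.
    by apply/funext => x; rewrite mxE.
  exact: measurable_coord.
have hdK p : hd (row_cons p) = p.1.
  by rewrite /hd /row_cons (@row_mxEl R 1 1 n) mxE eqxx mulr1n.
have tlK p : tl (row_cons p) = p.2 by exact: (@row_mxKr R 1 1 n).
exists (fun k => (hd @^-1` F k) `&` (tl @^-1` G k)).
  apply/seteqP; split=> // x _.
  have [i _ Fi] : (\bigcup_i F i) (hd x) by rewrite -TF.
  have [j _ Gj] : (\bigcup_i G i) (tl x) by rewrite -TG.
  exists (maxn i j) => //; split => /=.
    by move: (hd x) Fi; exact/subsetPset/ndF/leq_maxl.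
  by move: (tl x) Gj; exact/subsetPset/ndG/leq_maxr.
move=> k; have [mF Fk] := Foo k; have [mG Gk] := Goo k; split.
  apply: measurableI.
    by rewrite -[X in measurable X]setTI; exact: mhd.
  by rewrite -[X in measurable X]setTI; exact: mtl.
rewrite /row_cons_measure /pushforward.
rewrite (_ : _ @^-1` _ = F k `*` G k); last first.
  by apply/seteqP; split=> p /=; rewrite hdK tlK.
by rewrite product_measure1E// lte_mul_pinfty// ge0_fin_numE.
Qed.

HB.instance Definition _ := Measure_isSigmaFinite.Build _ _ _ row_cons_measure
  row_cons_measure_sigma_finite.

End row_cons_measure.

Section lebesgue_rV.
Context {R : realType}.

(* product measure on 'rV[R]_n; for n = 0 it is the unit mass at the only point *)
Fixpoint borel_lebesgue_rV (n : nat) :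
    {sigma_finite_measure set (@borel_rV R n) -> \bar R} :=
  match n with
  | 0 => @dirac _ (borel_rV 0) (0%R : 'rV[R]_0) R
  | n'.+1 => row_cons_measure (borel_lebesgue_rV n')
  end.

(* 'rV[R]_n with the Lebesgue (completed Borel) sigma-algebra *)
Definition lebesgue_rVType (n : nat) :=
  caratheodory_type (mu_ext (borel_lebesgue_rV n)).

HB.instance Definition _ (n : nat) := Measurable.on (lebesgue_rVType n).

Definition lebesgue_rV (n : nat) : set (lebesgue_rVType n) -> \bar R :=
  @completed_measure_extension _ _ _ (borel_lebesgue_rV n).

HB.instance Definition _ (n : nat) := Measure.on (@lebesgue_rV n).

End lebesgue_rV.
Arguments lebesgue_rVType R n : clear implicits.
Arguments lebesgue_rV R n : clear implicits.

(* characterizes lebesgue_rV: the measure of a product set *)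
Lemma lebesgue_rV_prod (R : realType) n (A : 'I_n -> set (measurableTypeR R)) :
  (forall i, measurable (A i)) ->
  lebesgue_rV R n [set x : 'rV[R]_n | forall i, A i (x ord0 i)] =
    (\prod_(i < n) lebesgue_measure (A i))%E.
Proof.
move=> mA; rewrite /lebesgue_rV /completed_measure_extension.
have mbox m (B : 'I_m -> set (measurableTypeR R)) : (forall i, measurable (B i)) ->
   measurable ([set x | forall i, B i ((x : 'rV[R]_m) ord0 i)] : set (borel_rV m)).
  move=> mB; rewrite (_ : [set _ | _] =
     \big[setI/setT]_(i < m) ((fun x : borel_rV m => (x : 'rV[R]_m) ord0 i) @^-1` B i)).
    apply: bigsetI_measurable => i _; rewrite -[X in measurable X]setTI.
    exact: measurable_coord.
  by rewrite -bigcap_seq; apply/seteqP; split => x /= h i => [_|]; 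
     [exact: h| apply: (h i); rewrite /= mem_index_enum].
rewrite measurable_mu_extE/=; last exact: mbox.
elim: n A mA => [|n IH] A mA.
  by rewrite big_ord0 /= diracE mem_set// => -[].
rewrite big_ord_recl /= -IH => [|i]; last exact: mA.
rewrite /row_cons_measure /pushforward -product_measure1E//; last by apply: (mbox n (fun i => A (lift ord0 i))) => i; exact: mA.
congr (product_measure1 _ _ _).
have hd p : (row_cons p : 'rV[R]_n.+1) ord0 ord0 = p.1.
  rewrite (_ : ord0 = @lshift 1 n ord0); last exact/val_inj.
  by rewrite /row_cons (@row_mxEl R 1 1 n) mxE eqxx mulr1n.
have tl p i : (row_cons p : 'rV[R]_n.+1) ord0 (lift ord0 i) = (p.2 : 'rV[R]_n) ord0 i.
  rewrite (_ : lift ord0 i = rshift 1 i); last exact/val_inj.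
  by rewrite /row_cons (@row_mxEr R 1 1 n).
apply/seteqP; split => p /= h.
  by split=> [|i]; rewrite -?hd -?tl; exact: h.
move=> i; case: (unliftP ord0 i) => [j|] ->; rewrite ?hd ?tl; first exact: h.2.
exact: h.1.
Qed.

Section amalgam.
Context {R : realType} {d : nat}.

(* `|x| on 'rV[R]_d is the sup norm of the library, hence a separate definition *)
Definition enorm (x : 'rV[R]_d) : R := Num.sqrt (\sum_(i < d) x ord0 i ^+ 2).

Definition Qset (n : 'rV[int]_d) : set 'rV[R]_d :=
  [set x | enorm (x - map_mx intr n) <= Num.sqrt d%:R].

Local Open Scope ereal_scope.

(* essential supremum of |f| over Qset n, as the L^oo norm of f times the
   indicator function of Qset n *)
Definition Linfty_Q (f : 'rV[R]_d -> R) (n : 'rV[int]_d) : \bar R :=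
  Lnorm (lebesgue_rV R d) +oo ((EFin \o f) \_ (Qset n)).

Definition amalgam_norm (p : \bar R) (f : 'rV[R]_d -> R) : \bar R :=
  match p with
  | r%:E => (\esum_(n in [set: 'rV[int]_d]) (Linfty_Q f n `^ r)) `^ r^-1
  | +oo => ereal_sup [set Linfty_Q f n | n in [set: 'rV[int]_d]]
  | -oo => 0 (* irrelevant: p is always in [1, +oo] *)
  end.

End amalgam.

(* Main.v *)
Require Import Defs.
From HB Require Import structures.
From mathcomp Require Import all_boot all_order all_algebra.
From mathcomp Require Import all_classical all_reals all_analysis.
From mathcomp Require Import measurable_realfun ess_sup_inf ring lra zify.

Set Implicit Arguments.
Unset Strict Implicit.
Unset Printing Implicit Defensive.

Import Order.TTheory GRing.Theory Num.Theory.
Import numFieldNormedType.Exports.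

Local Open Scope classical_set_scope.
Local Open Scope ring_scope.

(* Sufficiency. Replacing each [f j] by its suprema over unit cubes reduces the
   integral to a sum over the lattice points [a] of R^d of the products of
   [mu_j (B (l_j a, rho)) `^ s_j], where [s_j = 1 / p_j] and [mu_j] is a finite
   combination of point masses. This discrete inequality is proved for all
   linear maps and all radii by induction on the dimension. For masses of total
   at most 1 it is log-convex in the exponents and gets stronger as they decrease. If at
   least two exponents lie strictly between 0 and 1, they can be moved in
   opposite directions, keeping [sum_j s_j dim (l_j R^d)] constant, until one of
   them becomes 0 or 1 or some proper subspace V becomes critical, that is
   [dim V = sum_j s_j dim (l_j V)]; in the last case the inequality follows from
   those for V and for R^d / V. If at most one exponent is fractional, the maps
   [l_j] with [s_j = 1] are jointly injective and expanding the product suffices.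

   Necessity. Given V of dimension r, place T^r separated unit cubes along V and
   take for [f j] the indicator function of a neighbourhood of the images of their
   corners: the integral is at least T^r while the right-hand side is
   O(T^(sum_j s_j dim (l_j V))). *)

Local Notation "k %:V" := (map_mx intr k) (at level 2, format "k %:V").

(** * Integer points and sparse families *)

Section lattice.
Context {R : realType}.

Lemma rV_norm_leP n (x : 'rV[R]_n) (c : R) :
  0 <= c -> `|x| <= c <-> forall i, `|x ord0 i| <= c.
Proof.
move=> c0; rewrite {1}/Num.norm /= mx_normrE; split.
  by move=> /bigmax_leP[_ h] i; exact: (h (ord0, i)).
by move=> h; apply/bigmax_leP; split=> // -[i j] _ /=; rewrite ord1.
Qed.

Lemma coord_le_norm n (x : 'rV[R]_n) i : `|x ord0 i| <= `|x|.
Proof. by move: i; apply/rV_norm_leP. Qed.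

Lemma mulmx_norm_bound n m (M : 'M[R]_(n, m)) :
  exists2 K, 0 <= K & forall x : 'rV_n, `|x *m M| <= K * `|x|.
Proof.
exists (\sum_i \sum_j `|M i j|); first by rewrite !sumr_ge0// => i _; rewrite sumr_ge0.
move=> x; apply/rV_norm_leP => [|j].
  by rewrite mulr_ge0// sumr_ge0// => i _; rewrite sumr_ge0.
rewrite mxE (le_trans (ler_norm_sum _ _ _))// mulr_suml ler_sum// => i _.
rewrite normrM mulrC ler_pM ?coord_le_norm//.
by rewrite (bigD1 j)//= lerDl sumr_ge0.
Qed.

Definition floorv n (x : 'rV[R]_n) : 'rV[int]_n := map_mx Num.floor x.

Lemma floorv_dist n (x : 'rV[R]_n) : `|x - (floorv x)%:V| <= 1.
Proof.
apply/rV_norm_leP => // i; rewrite !mxE.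
have := floor_itv (x ord0 i); rewrite intrD ler_norml => h; apply/andP; split; lra.
Qed.

Lemma floorv_int n (k : 'rV[int]_n) : floorv k%:V = k.
Proof. by apply/rowP => i; rewrite !mxE intrKfloor. Qed.

(** Each coordinate of such a [k] is [Num.floor (x ord0 i) - t] plus a natural number below
    [t.*2.+2], so the candidates are indexed by functions into ['I_(t.*2.+2)]. *)
Lemma near_int n (t : nat) (x : 'rV[R]_n) : exists s : seq 'rV[int]_n,
  [/\ uniq s, (size s <= (t.*2.+2) ^ n)%N &
      forall k, (k \in s) = (`|k%:V - x| <= t%:R)].
Proof.
pose g (e : {ffun 'I_n -> 'I_(t.*2.+2)}) : 'rV[int]_n :=
  \row_i (Num.floor (x ord0 i) - t%:Z + (e i)%:Z).
pose P (k : 'rV[int]_n) := `|k%:V - x| <= t%:R.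
exists (undup [seq k <- codom g | P k]); split; first exact: undup_uniq.
  apply: leq_trans (size_undup _) _; rewrite size_filter.
  by apply: leq_trans (count_size _ _) _; rewrite size_codom card_ffun !card_ord.
move=> k; rewrite mem_undup mem_filter -/(P k).
have [Pk|//] := boolP (P k); rewrite /=.
apply/codomP; exists [ffun i => inord (absz (k ord0 i - (Num.floor (x ord0 i) - t%:Z))%R)].
apply/rowP => i; rewrite mxE ffunE.
have : `|k%:V - x| <= t%:R := Pk.
move/rV_norm_leP => /(_ (ler0n _ _) i); rewrite !mxE ler_norml => h.
have := floor_itv (x ord0 i); rewrite intrD; set f := Num.floor _ => fi.
have h1 : f - t%:Z <= k ord0 i.
  rewrite -(ler_int R) intrD rmorphN /= -[t%:~R]/(t%:R); lra.
have h2 : k ord0 i - (f - t%:Z) < (t.*2.+2)%:Z.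
  rewrite -(ltr_int R) !intrD !rmorphN /= intrD rmorphN /= -[t%:~R]/(t%:R : R).
  rewrite (_ : (t.*2.+2)%:~R = t%:R + t%:R + 2 :> R); last first.
    by rewrite -natrD addnn -natrD addn2.
  lra.
have {}h1 : 0 <= k ord0 i - (f - t%:Z) by rewrite subr_ge0.
rewrite inordK; last by rewrite -ltz_nat gez0_abs.
by rewrite gez0_abs// addrC subrK.
Qed.

(** A discrete stand-in for Lebesgue measure. The points are real and weighted, so that coordinates
    along a subspace or a complement can again serve as such families. *)
Definition sparse n (J : finType) (a : J -> 'rV[R]_n) (u : J -> R) :=
  forall k, \sum_(al | floorv (a al) == k) u al <= 1.

Lemma sparse_ball n (rho : R) : exists2 K : R, 0 <= K &
  forall (J : finType) (a : J -> 'rV[R]_n) (u : J -> R),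
    (forall al, 0 <= u al) -> sparse a u ->
    forall x, \sum_(al | `|a al - x| <= rho) u al <= K.
Proof.
pose t := Num.bound (rho + 1).
exists ((t.*2.+2) ^ n)%:R => // J a u u0 sp x.
have [s [us ss sP]] := near_int t x.
have in_s al : `|a al - x| <= rho -> floorv (a al) \in s.
  move=> h; rewrite sP.
  have := floorv_dist (a al) => h2.
  rewrite (_ : _ - x = (a al - x) - (a al - (floorv (a al))%:V)); last first.
    by rewrite opprB [RHS]addrC addrA subrK.
  apply: le_trans (ler_normB _ _) _.
  apply: le_trans (ltW (archi_boundP _)); first by rewrite lerD.
  by rewrite addr_ge0// (le_trans _ h).
apply: (@le_trans _ _ (\sum_(k <- s) \sum_(al | floorv (a al) == k) u al)).
  rewrite (exchange_big_dep predT)//= (bigID (fun al => `|a al - x| <= rho) predT)/=.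
  rewrite -[leLHS]addr0 lerD//.
    apply: ler_sum => al h; rewrite big_const_seq.
    have : (0 < count (fun k => floorv (a al) == k) s)%N.
      by rewrite -has_count; apply/hasP; exists (floorv (a al)); rewrite ?in_s.
    case: (count _ _) => // c _; rewrite iter_addr_0 mulrS.
    by rewrite lerDl mulrn_wge0.
  by rewrite sumr_ge0// => al _; rewrite sumr_ge0.
apply: (@le_trans _ _ (\sum_(k <- s) 1)); first exact: ler_sum.
by rewrite big_const_seq count_predT iter_addr_0 ler_nat.
Qed.

End lattice.

(** * The discrete inequality *)

Section discrete.
Context {R : realType}.

Definition mass (I : finType) m (z : I -> 'rV[R]_m) (w : I -> R) rho x :=
  \sum_(i | `|z i - x| <= rho) w i.

Lemma mass_ge0 (I : finType) m (z : I -> 'rV[R]_m) (w : I -> R) rho x :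
  (forall i, 0 <= w i) -> 0 <= mass z w rho x.
Proof. by move=> w0; apply: sumr_ge0. Qed.

Lemma mass_le_total (I : finType) m (z : I -> 'rV[R]_m) (w : I -> R) rho x :
  (forall i, 0 <= w i) -> mass z w rho x <= \sum_i w i.
Proof.
by move=> w0; rewrite [leRHS](bigID (fun i => `|z i - x| <= rho))/= lerDl sumr_ge0.
Qed.

(** All radii are included because splitting along a subspace enlarges [rho]; total masses at most 1
    make the bound monotone in [s]. *)
Definition discrete_bound N n (m : 'I_N -> nat) (L : forall j, 'M[R]_(n, m j)) (s : 'I_N -> R) :=
  forall rho, exists C, forall (J I : finType) (a : J -> 'rV[R]_n) (u : J -> R)
    (z : forall j, I -> 'rV[R]_(m j)) (w : 'I_N -> I -> R),
    (forall al, 0 <= u al) -> sparse a u ->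
    (forall j i, 0 <= w j i) -> (forall j, \sum_i w j i <= 1) ->
    \sum_al u al * \prod_j mass (z j) (w j) rho (a al *m L j) `^ s j <= C.

(** Dividing [u] by [K] and each [w j] by its total reduces to the normalised case. When such a
    divisor is 0 the weights that it bounds all vanish, in agreement with division by 0 being 0. *)
Lemma discrete_bound_homogeneous N n (m : 'I_N -> nat) (L : forall j, 'M[R]_(n, m j)) s :
  discrete_bound L s -> forall rho, exists2 C, 0 <= C &
  forall (J I : finType) (a : J -> 'rV[R]_n) (u : J -> R)
    (z : forall j, I -> 'rV[R]_(m j)) (w : 'I_N -> I -> R) (K : R),
    (forall al, 0 <= u al) -> 0 <= K ->
    (forall k, \sum_(al | floorv (a al) == k) u al <= K) ->
    (forall j i, 0 <= w j i) ->
    \sum_al u al * \prod_j mass (z j) (w j) rho (a al *m L j) `^ s j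
      <= C * K * \prod_j (\sum_i w j i) `^ s j.
Proof.
move=> gL rho; have [C HC] := gL rho.
exists (Num.max 0 C); first by rewrite le_max lexx.
move=> J I a u z w K u0 K0 uK w0.
pose T j := \sum_i w j i.
have T0 j : 0 <= T j by apply: sumr_ge0.
have uE al : u al = K * (u al / K).
  have [K_eq0|Kn0] := eqVneq K 0; last by rewrite mulrC divfK.
  rewrite K_eq0 mul0r; apply/eqP; rewrite eq_le u0 andbT.
  rewrite -K_eq0 (le_trans _ (uK (floorv (a al))))//.
  by rewrite (bigD1 al)//= lerDl sumr_ge0.
have wE j i : w j i = T j * (w j i / T j).
  have [T_eq0|Tn0] := eqVneq (T j) 0; last by rewrite mulrC divfK.
  rewrite T_eq0 mul0r; apply/eqP; rewrite eq_le w0 andbT.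
  by rewrite -T_eq0 /T (bigD1 i)//= lerDl sumr_ge0.
have massE j x : mass (z j) (w j) rho x = T j * mass (z j) (fun i => w j i / T j) rho x.
  by rewrite /mass mulr_sumr; apply: eq_bigr => i _; rewrite -wE.
have -> : \sum_al u al * \prod_j mass (z j) (w j) rho (a al *m L j) `^ s j =
  K * \prod_j T j `^ s j * \sum_al (u al / K) * \prod_j
     mass (z j) (fun i => w j i / T j) rho (a al *m L j) `^ s j.
  rewrite mulr_sumr; apply: eq_bigr => al _.
  have -> : \prod_j mass (z j) (w j) rho (a al *m L j) `^ s j =
      \prod_j T j `^ s j *
      \prod_j mass (z j) (fun i => w j i / T j) rho (a al *m L j) `^ s j.
    rewrite -big_split/=; apply: eq_bigr => j _.
    by rewrite massE powRM// mass_ge0// => i; rewrite divr_ge0.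
  by rewrite {1}uE; ring.
rewrite mulrC -mulrA ler_pM//.
- rewrite sumr_ge0// => al _; rewrite mulr_ge0 ?divr_ge0//.
  by rewrite prodr_ge0// => j _; rewrite powR_ge0.
- by rewrite mulr_ge0// prodr_ge0// => j _; rewrite powR_ge0.
rewrite le_max; apply/orP; right; apply: HC.
- by move=> al; rewrite divr_ge0.
- move=> k; rewrite -mulr_suml.
  have [->|Kn0] := eqVneq K 0; first by rewrite invr0 mulr0.
  by rewrite ler_pdivrMr ?mul1r// lt_def Kn0.
- by move=> j i; rewrite divr_ge0.
- move=> j; rewrite -mulr_suml -/(T j).
  by have [->|Tn0] := eqVneq (T j) 0; rewrite ?mul0r// divff.
Qed.

(** Each mass lies in [0, 1], where powers decrease as the exponent grows. *)
Lemma discrete_bound_antitone N n (m : 'I_N -> nat) (L : forall j, 'M[R]_(n, m j)) s s' :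
  (forall j, 0 <= s' j <= s j) -> discrete_bound L s' -> discrete_bound L s.
Proof.
move=> ss gL rho; have [C HC] := gL rho; exists C => J I a u z w u0 sp w0 w1.
apply: le_trans (HC J I a u z w u0 sp w0 w1).
apply: ler_sum => al _; rewrite ler_wpM2l//; apply: ler_prod => j _.
rewrite powR_ge0/=; set x := mass _ _ _ _.
have x0 : 0 <= x by apply: mass_ge0.
have x1 : x <= 1 by apply: le_trans (w1 j); apply: mass_le_total.
have /andP[s0 s1] := ss j.
have [->|xn0] := eqVneq x 0; last by rewrite ger_powR// x1 lt_def xn0 x0.
(* A zero mass has power 1 for exponent 0 and power 0 otherwise; [s j = 0] forces [s' j = 0]. *)
rewrite /powR eqxx; have [sj|] := eqVneq (s j) 0; last by rewrite ler0n.
by rewrite (_ : s' j = 0) ?eqxx//; apply/eqP; rewrite eq_le s0 -sj s1.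
Qed.

Lemma powR_prod (I : finType) (F : I -> R) r : (forall i, 0 <= F i) ->
  (\prod_i F i) `^ r = \prod_i F i `^ r.
Proof.
move=> F0; pose P (x y : R) := 0 <= x /\ x `^ r = y.
suff [] : P (\prod_i F i) (\prod_i F i `^ r) by [].
apply: (big_rec2 P) => [|i x y _ [x0 <-]]; first by rewrite /P powR1.
by split; [exact: mulr_ge0 | rewrite powRM].
Qed.

Lemma powR_conv (x r t theta : R) : 0 <= r -> 0 <= t -> 0 < theta < 1 ->
  x `^ (theta * r + (1 - theta) * t) = (x `^ r) `^ theta * (x `^ t) `^ (1 - theta).
Proof.
move=> r0 t0 /andP[th0 th1]; have th1' : 0 < 1 - theta by rewrite subr_gt0.
have h1 : 0 <= theta * r by rewrite mulr_ge0// ltW.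
have h2 : 0 <= (1 - theta) * t by rewrite mulr_ge0// ltW.
have [/eqP|sn0] := eqVneq (theta * r + (1 - theta) * t) 0.
  rewrite paddr_eq0// !mulf_eq0 (gt_eqF th0) (gt_eqF th1')/=.
  by move=> /andP[/eqP-> /eqP->]; rewrite !mulr0 addr0 !powRr0 !powR1 mulr1.
by rewrite powRD ?(negbTE sn0)// [theta * r]mulrC [_ * t]mulrC !powRrM.
Qed.

(** A crude form of Young's inequality: the weighted geometric mean is at most the maximum, which is
    at most the sum. *)
Lemma geo_le_add (X Y theta : R) : 0 <= X -> 0 <= Y -> 0 < theta < 1 ->
  X `^ theta * Y `^ (1 - theta) <= X + Y.
Proof.
move=> X0 Y0 /[dup] th /andP[th0 th1].
have th1' : 0 < 1 - theta by rewrite subr_gt0.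
pose M := Num.max X Y.
have M0 : 0 <= M by rewrite le_max X0.
apply: (@le_trans _ _ (M `^ theta * M `^ (1 - theta))).
  by rewrite ler_pM ?powR_ge0// ge0_ler_powR ?nnegrE ?(ltW th0) ?(ltW th1')// le_max lexx ?orbT.
have := @powR_conv M 1 1 theta ler01 ler01 th.
rewrite !mulr1 [theta + _]addrC subrK !powRr1// => <-.
by rewrite ge_max lerDl lerDr X0 Y0.
Qed.

(** Each product of masses for [s] is a weighted geometric mean of those for [s1] and [s2], hence at
    most their sum; the constants add up. *)
Lemma discrete_bound_convex N n (m : 'I_N -> nat) (L : forall j, 'M[R]_(n, m j)) s s1 s2 theta :
  0 < theta < 1 -> (forall j, 0 <= s1 j) -> (forall j, 0 <= s2 j) ->
  (forall j, s j = theta * s1 j + (1 - theta) * s2 j) ->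
  discrete_bound L s1 -> discrete_bound L s2 -> discrete_bound L s.
Proof.
move=> th s10 s20 sE g1 g2 rho.
have [C1 H1] := g1 rho; have [C2 H2] := g2 rho; exists (C1 + C2).
move=> J I a u z w u0 sp w0 w1.
apply: le_trans (lerD (H1 J I a u z w u0 sp w0 w1) (H2 J I a u z w u0 sp w0 w1)).
rewrite -big_split; apply: ler_sum => al _ /=; rewrite -mulrDr ler_wpM2l//.
have -> : \prod_j mass (z j) (w j) rho (a al *m L j) `^ s j =
  (\prod_j mass (z j) (w j) rho (a al *m L j) `^ s1 j) `^ theta *
  (\prod_j mass (z j) (w j) rho (a al *m L j) `^ s2 j) `^ (1 - theta).
  rewrite !powR_prod; try by move=> *; rewrite powR_ge0.
  by rewrite -big_split/=; apply: eq_bigr => j _; rewrite sE powR_conv.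
by apply: geo_le_add => //; apply: prodr_ge0 => j _; rewrite powR_ge0.
Qed.

End discrete.

(** * Jointly injective maps with exponent one *)

Section terminal.
Context {R : realType}.

(** Placed side by side, with 0 for the maps outside [S], the matrices form one injective matrix,
    whose pseudo-inverse is bounded. *)
Lemma joint_inverse_bound N n (m : 'I_N -> nat) (L : forall j, 'M[R]_(n, m j))
    (S : pred 'I_N) :
  (forall x : 'rV_n, (forall j, S j -> x *m L j = 0) -> x = 0) ->
  exists2 K, 0 <= K & forall (x : 'rV_n) c, 0 <= c ->
    (forall j, S j -> `|x *m L j| <= c) -> `|x| <= K * c.
Proof.
move=> Linj; pose M j := if S j then L j else 0.
pose A := \mxrow_j M j.
have Afree : row_free A.
  rewrite -kermx_eq0; apply/eqP/row_matrixP => i; rewrite row0; apply: Linj => j Sj.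
  have := congr1 (fun B => submxrow B j) (mulmx_ker A).
  rewrite /A mul_mxrow mxrowK submxrow0 /M Sj => h.
  by rewrite -row_mul h row0.
have [K K0 HK] := mulmx_norm_bound (pinvmx A).
exists K => // x c c0 xc.
rewrite -[x in `|x|](mulmxKp Afree x) (le_trans (HK _))// ler_wpM2l//.
apply/rV_norm_leP => // i; rewrite /A mul_mxrow mxE; set j := tagnat.sig1 i.
have := xc j; rewrite /M; case: (S j) => [h|_]; last by rewrite mulmx0 mxE normr0.
by rewrite (le_trans (coord_le_norm _ _))// h.
Qed.

(** Factors outside [S] are at most 1. Expanding the others gives a sum over choices [f] of one atom
    per [j]. The points whose images are close to all chosen atoms lie in one ball by joint
    injectivity, so their weight is bounded, and the products of the weights of the atoms sum to at
    most 1. *)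
Lemma discrete_bound_inj N n (m : 'I_N -> nat) (L : forall j, 'M[R]_(n, m j)) s (S : pred 'I_N) :
  (forall j, 0 <= s j) -> (forall j, S j -> s j = 1) ->
  (forall x : 'rV_n, (forall j, S j -> x *m L j = 0) -> x = 0) -> discrete_bound L s.
Proof.
move=> s0 s1 Linj rho.
have [K K0 HK] := joint_inverse_bound Linj.
(* Two points close to the same atoms have images at most [2 * rho] apart for every [j] in [S]; the
   absolute value keeps the radius nonnegative. *)
have [B B0 HB] := sparse_ball (R := R) n (K * (2 * `|rho|)).
exists B => J I a u z w u0 sp w0 w1.
pose x j al := mass (z j) (w j) rho (a al *m L j).
have x0 j al : 0 <= x j al by apply: mass_ge0.
have x1 j al : x j al <= 1 by apply: le_trans (w1 j); apply: mass_le_total.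
apply: (@le_trans _ _ (\sum_al u al * \prod_(j | S j) x j al)).
  apply: ler_sum => al _; rewrite ler_wpM2l// [leRHS]big_mkcond/=.
  apply: ler_prod => j _; rewrite powR_ge0/=.
  case: ifPn => [/s1 ->|_]; first by rewrite powRr1 ?x0.
  have := @ge0_ler_powR R (s j) (s0 j) (x j al) 1; rewrite powR1.
  by apply; rewrite ?nnegrE ?x0 ?ler01 ?x1.
pose E j i al : R := (`|z j i - a al *m L j| <= rho)%R%:R.
have xE j al : x j al = \sum_i w j i * E j i al.
  rewrite /x /mass big_mkcond; apply: eq_bigr => i _.
  by rewrite /E; case: ifP; rewrite ?mulr1 ?mulr0.
have bnd (f : 'I_N -> I) : \sum_al u al * \prod_(j | S j) E j (f j) al <= B.
  pose P al := [forall (j | S j), `|z j (f j) - a al *m L j| <= rho].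
  apply: (@le_trans _ _ (\sum_(al | P al) u al)).
    rewrite [leRHS]big_mkcond; apply: ler_sum => al _.
    case: ifPn => [_|/forall_inPn[j Sj /negbTE h]].
      rewrite ler_piMr//.
      by apply: prodr_ile1 => j _; rewrite /E ler0n lern1 leq_b1.
    by rewrite (bigD1 j)//= {1}/E h mul0r mulr0.
  have [al0 Pal0|noP] := pickP P; last by rewrite big_pred0.
  apply: le_trans (HB J a u u0 sp (a al0)).
  rewrite [leRHS](bigID P)/= -[leLHS]addr0 lerD ?sumr_ge0//.
  rewrite le_eqVlt; apply/orP; left; apply/eqP; apply: eq_bigl => al.
  apply/idP/idP => [Pal|/andP[]//]; rewrite Pal andbT.
  apply: HK => [|j Sj]; first by rewrite mulr_ge0.
  have h := forall_inP Pal j Sj; have h0 := forall_inP Pal0 j Sj.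
  rewrite mulmxBl (_ : _ - _ = (z j (f j) - a al0 *m L j) - (z j (f j) - a al *m L j)).
    rewrite (le_trans (ler_normB _ _))// mulr_natl mulr2n.
    by rewrite lerD// (le_trans _ (ler_norm _)).
  by rewrite opprB [RHS]addrC addrA subrK.
(* Distributivity needs a default atom. Without atoms, a factor with [j] in [S] is an empty sum; if
   [S] is empty too, joint injectivity makes every point 0. *)
have [i0 _|I0] := pickP (fun _ : I => true); last first.
  have [j Sj|S0] := pickP S.
    rewrite big1// => al _; have xj0 : x j al = 0 by rewrite xE big_pred0.
    by rewrite (bigD1 j)//= xj0 mul0r mulr0.
  apply: le_trans (HB J a u u0 sp 0); rewrite [leRHS]big_mkcond/=.
  apply: ler_sum => al _; rewrite big_pred0// mulr1 (Linj (a al)) ?subr0 ?normr0.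
    by rewrite mulr_ge0// mulr_ge0.
  by move=> j; rewrite S0.
under eq_bigr => al _.
  under eq_bigr => j _ do rewrite xE.
  rewrite (big_distr_big i0) mulr_sumr.
  under eq_bigr => f _ do rewrite big_split/= mulrCA.
  over.
rewrite exchange_big/=.
under eq_bigr do rewrite -mulr_sumr.
apply: (@le_trans _ _ (\sum_(f in pffun_on i0 S predT) (\prod_(j | S j) w j (f j)) * B)).
  by apply: ler_sum => f _; rewrite ler_wpM2l// prodr_ge0.
rewrite -mulr_suml -(big_distr_big i0) ler_piMl//.
by apply: prodr_ile1 => j _; rewrite w1 sumr_ge0.
Qed.

End terminal.

(** * Splitting along a subspace and a complement *)

Section split.
Context {R : realType}.

Lemma mulmx_norm_bound_fam N (n m : 'I_N -> nat) (M : forall j, 'M[R]_(n j, m j)) :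
  exists2 K, 0 <= K & forall j (x : 'rV_(n j)), `|x *m M j| <= K * `|x|.
Proof.
have /choice[K HK] j : exists K, 0 <= K /\ forall x : 'rV_(n j), `|x *m M j| <= K * `|x|.
  by have [K] := mulmx_norm_bound (M j); exists K.
exists (\sum_j K j); first by apply: sumr_ge0 => j _; case: (HK j).
move=> j x; have [K0 Kj] := HK j; rewrite (le_trans (Kj x))// ler_wpM2r//.
by rewrite (bigD1 j)//= lerDl sumr_ge0// => i _; case: (HK i).
Qed.

(* A point is determined by its coordinates v along B and w along B'. Among the
   points with w in a given unit cell, the first bound applies to the
   coordinates v and to the masses within bounded distance of the corresponding
   fibres; the second bound sums the resulting total masses over the cells. *)
Lemma discrete_bound_split N n r r' (m m' : 'I_N -> nat) (L : forall j, 'M[R]_(n, m j)) s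
    (B : 'M[R]_(r, n)) (B' : 'M[R]_(r', n)) (P : 'M[R]_(n, r)) (P' : 'M[R]_(n, r'))
    (Q : forall j, 'M[R]_(m j, m' j)) :
  P *m B + P' *m B' = 1%:M -> (forall j, B *m L j *m Q j = 0) ->
  (forall j, 0 <= s j) ->
  discrete_bound (fun j => B *m L j) s ->
  discrete_bound (fun j => B' *m L j *m Q j) s -> discrete_bound L s.
Proof.
move=> PB BLQ s0 gV gQ rho.
have [c c0 Hc] := mulmx_norm_bound_fam (fun j => B' *m L j).
have [c' c'0 Hc'] := mulmx_norm_bound_fam (fun j => B' *m L j *m Q j).
have [k k0 Hk] := mulmx_norm_bound_fam Q.
have [b b0 Hb] := mulmx_norm_bound B; have [b' b'0 Hb'] := mulmx_norm_bound B'.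
(* Points whose two coordinates each lie in a fixed unit cell are within [b + b'] of the point given
   by the corners of these cells. *)
have [B0 B00 HB0] := sparse_ball (R := R) n (b + b').
(* Inside a cell the coordinate along [B'] varies by at most 2, which moves the images by at most
   [c * 2] and [c' * 2]; [Q j] stretches [rho] by at most [k]. *)
have [C1 C10 H1] := discrete_bound_homogeneous gV (rho + c * 2).
have [C2 H2] := gQ (k * rho + c' * 2).
exists (C1 * B0 * C2) => J I a u z w u0 sp w0 w1.
pose p al := a al *m P'; pose v al := a al *m P.
have aE al : a al = v al *m B + p al *m B'.
  by rewrite /v /p -!mulmxA -mulmxDr PB mulmx1.
pose rep al := odflt al [pick be | floorv (p be) == floorv (p al)].
have fl_rep al : floorv (p (rep al)) = floorv (p al).
  by rewrite /rep; case: pickP => [be /eqP|].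
have rep_eq al be : floorv (p al) = floorv (p be) -> rep al = rep be.
  move=> e; rewrite /rep e; case: pickP => [//|/(_ be)]; by rewrite eqxx.
have rep_id al : rep (rep al) = rep al by apply: rep_eq.
have p_near al : `|p al - p (rep al)| <= 2.
  rewrite (_ : _ - _ = (p al - (floorv (p al))%:V) - (p (rep al) - (floorv (p (rep al)))%:V)).
    by rewrite (le_trans (ler_normB _ _))// (_ : 2 = 1 + 1 :> R)// lerD// floorv_dist.
  by rewrite fl_rep; apply/rowP => i; rewrite !mxE; ring.
pose T j be := mass (fun i => z j i *m Q j) (w j) (k * rho + c' * 2) (p be *m (B' *m L j *m Q j)).
have T0 j be : 0 <= T j be by apply: mass_ge0.
have fiber be : \sum_(al | rep al == be)
    u al * \prod_j mass (z j) (w j) rho (a al *m L j) `^ s j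
    <= (rep be == be)%:R * (C1 * B0 * \prod_j T j be `^ s j).
  have [be_rep|/eqP be_rep] := eqVneq (rep be) be; last first.
    rewrite mul0r big1// => al /eqP e; exfalso.
    by apply: be_rep; rewrite -e rep_id.
  rewrite mul1r.
  (* The data of one cell: weights restricted to it, atoms restricted to those that [Q j] sends
     close to the image of [p be], and positions recentred so that only the coordinate [v]
     matters. *)
  pose u' al := if rep al == be then u al else 0.
  pose w' j i := if `|z j i *m Q j - p be *m (B' *m L j *m Q j)| <= k * rho + c' * 2
    then w j i else 0.
  pose z' j i := z j i - p be *m (B' *m L j).
  have u'0 al : 0 <= u' al by rewrite /u'; case: ifP.
  have w'0 j i : 0 <= w' j i by rewrite /w'; case: ifP.
  have sp' q : \sum_(al | floorv (v al) == q) u' al <= B0.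
    apply: le_trans (HB0 J a u u0 sp (q%:V *m B + (floorv (p be))%:V *m B')).
    rewrite -big_mkcondr [leRHS]big_mkcond [leLHS]big_mkcond.
    apply: ler_sum => al _; case: ifPn => [/andP[/eqP vq /eqP e]|_]; last by case: ifP.
    rewrite ifT// aE (_ : _ - _ = (v al - q%:V) *m B + (p al - (floorv (p be))%:V) *m B').
      rewrite (le_trans (ler_normD _ _))// lerD//.
        rewrite (le_trans (Hb _))// -vq -[leRHS]mulr1 ler_wpM2l//; exact: floorv_dist.
      rewrite (le_trans (Hb' _))// -e fl_rep -[leRHS]mulr1 ler_wpM2l//; exact: floorv_dist.
    by rewrite !mulmxBl; apply/rowP => i; rewrite !mxE; ring.
  have := H1 J I v u' z' w' B0 u'0 B00 sp' w'0.
  have -> : \prod_j (\sum_i w' j i) `^ s j = \prod_j T j be `^ s j.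
    by apply: eq_bigr => j _; rewrite /T /mass [in RHS]big_mkcond.
  apply: le_trans; rewrite big_mkcond; apply: ler_sum => al _.
  rewrite /u'; case: ifPn => [/eqP e|_]; last by rewrite mul0r.
  rewrite ler_wpM2l//; apply: ler_prod => j _; rewrite powR_ge0/=.
  apply: ge0_ler_powR; rewrite ?nnegrE ?mass_ge0//.
  have zv i : z' j i - v al *m (B *m L j) =
      (z j i - a al *m L j) + (p al - p be) *m (B' *m L j).
    rewrite /z' {1}aE mulmxBl mulmxDl -!mulmxA.
    by apply/rowP => i'; rewrite !mxE; ring.
  (* [Q j] kills the images of [B], so [v al] drops out after [Q j]. *)
  have zQ i : z j i *m Q j - p be *m (B' *m L j *m Q j) =
      (z j i - a al *m L j) *m Q j + (p al - p be) *m (B' *m L j *m Q j).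
    have -> : (z j i - a al *m L j) *m Q j = z j i *m Q j - p al *m (B' *m L j *m Q j).
      rewrite mulmxBl; congr (_ - _); rewrite {1}aE !mulmxDl.
      have BLQ' : B *m (L j *m Q j) = 0 by rewrite mulmxA.
      by rewrite -!mulmxA BLQ' !mulmx0 add0r.
    by rewrite mulmxBl; apply/rowP => i'; rewrite !mxE; ring.
  rewrite /mass [leLHS]big_mkcond [leRHS]big_mkcond; apply: ler_sum => i _.
  case: ifPn => [h|_]; last by case: ifP.
  have rho0 : 0 <= rho by apply: le_trans h.
  have near : `|p al - p be| <= 2 by rewrite -e.
  rewrite zv ifT; last first.
    by rewrite (le_trans (ler_normD _ _))// lerD// (le_trans (Hc _ _))// ler_wpM2l.
  rewrite /w' zQ ifT//.
  rewrite (le_trans (ler_normD _ _))// lerD//.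
    by rewrite (le_trans (Hk _ _))// ler_wpM2l.
  by rewrite (le_trans (Hc' _ _))// ler_wpM2l.
rewrite (partition_big rep predT)//=.
apply: le_trans (ler_sum _ (fun be _ => fiber be)) _.
under eq_bigr do rewrite mulrCA.
rewrite -mulr_sumr ler_wpM2l ?mulr_ge0//.
(* The second bound runs over the representatives, with weight 1 each: a unit cell contains at most
   one of them. *)
apply: H2 => // q.
have [be /andP[/eqP bq /eqP be_rep]|noq] :=
    pickP (fun be => (floorv (p be) == q) && (rep be == be)); last first.
  rewrite big1// => be hq; have := noq be; rewrite hq/= => ->; by [].
rewrite (bigD1 be) ?bq//= be_rep eqxx big1 ?addr0// => al /andP[/eqP aq nab].
case: eqP => // al_rep; exfalso; move/eqP: nab; apply.
by rewrite -al_rep -be_rep; apply: rep_eq; rewrite aq bq.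
Qed.

End split.

(** * Feasible exponents and critical subspaces *)

Section polytope.
Context {R : realType}.

Definition feasible N n (m : 'I_N -> nat) (L : forall j, 'M[R]_(n, m j)) (s : 'I_N -> R) :=
  forall V : 'M[R]_n, (\rank V)%:R <= \sum_j s j * (\rank (V *m L j))%:R.

Lemma feasible_rect N n (m : 'I_N -> nat) (L : forall j, 'M[R]_(n, m j)) s :
  feasible L s -> forall k (V : 'M[R]_(k, n)),
  (\rank V)%:R <= \sum_j s j * (\rank (V *m L j))%:R.
Proof.
move=> F k V; have := F <<V>>%MS; rewrite mxrank_gen => /le_trans; apply.
by apply: ler_sum => j _; rewrite (eqmxMr (L j) (genmxE V)).
Qed.

Lemma feasible_sub N n (m : 'I_N -> nat) (L : forall j, 'M[R]_(n, m j)) s (V : 'M[R]_n) :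
  feasible L s -> feasible (fun j => row_base V *m L j) s.
Proof.
move=> F U; have := feasible_rect F (U *m row_base V).
rewrite mxrankMfree ?row_base_free// => /le_trans; apply.
by under eq_bigr do rewrite -mulmxA.
Qed.

(** Rank-nullity for the quotient map [cokermx B] restricted to [(A + B)%MS], where its kernel is
    the row space of [B]. *)
Lemma mxrank_coker_add n1 n2 n3 (A : 'M[R]_(n1, n3)) (B : 'M[R]_(n2, n3)) :
  \rank (A *m cokermx B) + \rank B = \rank (A + B)%MS.
Proof.
rewrite -(mxrank_mul_ker (A + B)%MS (cokermx B)); congr addn.
  by rewrite addsmxMr mulmx_coker addsmx0.
suff /eqmxP-> : (B == (A + B) :&: kermx (cokermx B))%MS by [].
apply/andP; split.
  by rewrite sub_capmx addsmxSr/= sub_kermx mulmx_coker.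
by apply: submx_trans (capmxSr _ _) _; rewrite submxE mulmx_ker.
Qed.

(** The quotient by [V] is modelled by a complement of [V], and the quotients of the targets by
    [cokermx]. Subtracting the equality for [V] from the condition for [W + V] leaves the condition
    for the class of [W]. *)
Lemma feasible_quotient N n (m : 'I_N -> nat) (L : forall j, 'M[R]_(n, m j)) s (V : 'M[R]_n) :
  feasible L s -> (\rank V)%:R = \sum_j s j * (\rank (V *m L j))%:R ->
  feasible (fun j => row_base V^C%MS *m L j *m cokermx (row_base V *m L j)) s.
Proof.
move=> F crit U; pose W := U *m row_base V^C%MS.
have WV0 : (W :&: V)%MS = 0.
  apply/eqP; rewrite -submx0 -(capmx_compl V) capmxC capmxS//.
  by rewrite (submx_trans (submxMl _ _))// eq_row_base.
have := feasible_rect F (W + V)%MS.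
rewrite mxrank_disjoint_sum// natrD crit.
rewrite (_ : \rank W = \rank U); last by rewrite mxrankMfree ?row_base_free.
rewrite -lerBrDr -sumrB => /le_trans; apply; apply: ler_sum => j _.
rewrite -mulrBr.
have -> : (\rank ((W + V)%MS *m L j) =
  \rank (U *m (row_base V^C%MS *m L j *m cokermx (row_base V *m L j))) +
  \rank (V *m L j))%N.
  have eV : (row_base V *m L j :=: V *m L j)%MS by apply/eqmxMr/eq_row_base.
  rewrite addsmxMr (adds_eqmx (eqmx_refl (W *m L j)) (eqmx_sym eV)).
  by rewrite -mxrank_coker_add eV (mulmxA U (_ *m L j)) (mulmxA U (row_base _)).
by rewrite natrD addrK.
Qed.

(** Splitting with bases of [V] and of a complement as [B] and [B']; decomposing the identity matrix
    yields the coordinates [P] and [P']. *)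
Lemma discrete_bound_critical N n (m : 'I_N -> nat) (L : forall j, 'M[R]_(n, m j)) s (V : 'M[R]_n) :
  (forall j, 0 <= s j) ->
  discrete_bound (fun j => row_base V *m L j) s ->
  discrete_bound (fun j => row_base V^C%MS *m L j *m cokermx (row_base V *m L j)) s ->
  discrete_bound L s.
Proof.
move=> s0 gV gQ.
have /sub_addsmxP[[P P'] /= PE] : (1%:M <= row_base V + row_base V^C)%MS.
  rewrite (adds_eqmx (eq_row_base V) (eq_row_base V^C%MS)) sub1mx.
  exact: addsmx_compl_full.
by apply: (discrete_bound_split (P := P) (P' := P') _ _ s0 gV gQ) => // j; rewrite mulmx_coker.
Qed.

(** The ratio test of linear programming: [t] is the least [A c / B c] over the constraints that
    decrease, and a minimiser becomes tight. *)
Lemma max_step (T : finType) (A B : T -> R) :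
  (forall c, 0 <= A c) -> (exists c, 0 < B c) ->
  exists2 t, 0 <= t & (forall c, 0 <= A c - t * B c) /\
    exists c, 0 < B c /\ A c - t * B c = 0.
Proof.
move=> A0 [c0 Bc0].
have [c Bc cmin] := @Order.TotalTheory.arg_minP _ R T c0
  (fun c => 0 < B c) (fun c => A c / B c) Bc0.
exists (A c / B c); first by rewrite divr_ge0// ltW.
split; last by exists c; split=> //; rewrite divfK ?subrr// gt_eqF.
move=> c'; rewrite subr_ge0; have [Bc'|Bc'] := ltP 0 (B c').
  by rewrite -ler_pdivlMr// cmin.
by rewrite (le_trans _ (A0 c'))// mulr_ge0_le0// divr_ge0// ltW.
Qed.

(** With [x = \rank (L k)] and [y = \rank (L i)] this direction preserves the sum of
    [s j * \rank (L j)], hence the condition for the whole space. *)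
Definition shift_exponents N (s : 'I_N -> R) (i k : 'I_N) (x y t : R) : 'I_N -> R :=
  fun j => s j + t * (x * (j == i)%:R - y * (j == k)%:R).

Lemma sum_shift_exponents N (s : 'I_N -> R) (i k : 'I_N) (x y t : R) (f : 'I_N -> R) :
  \sum_j shift_exponents s i k x y t j * f j = \sum_j s j * f j + t * (x * f i - y * f k).
Proof.
have pick (l : 'I_N) : \sum_j (j == l)%:R * f j = f l.
  rewrite (bigD1 l)//= eqxx mul1r big1 ?addr0// => j /negbTE ->.
  by rewrite mul0r.
rewrite -(pick i) -(pick k) !mulr_sumr -sumrB mulr_sumr -big_split/=.
by apply: eq_bigr => j _; rewrite /shift_exponents; ring.
Qed.

(** The move continues until a first constraint becomes tight: a box constraint or the condition for
    some [V]. That [V] is neither 0 nor the whole space, whose conditions do not change along the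
    move. *)
Lemma feasible_move N n (m : 'I_N -> nat) (L : forall j, 'M[R]_(n, m j)) s i k :
  let d j := (\rank (L j))%:R : R in
  feasible L s -> (forall j, 0 <= s j <= 1) -> i != k -> 0 < d i -> 0 < d k ->
  exists2 t, 0 <= t & let s' := shift_exponents s i k (d k) (d i) t in
    [/\ feasible L s', forall j, 0 <= s' j <= 1 &
      [\/ s' i = 1, s' k = 0 | exists V : 'M[R]_n, (0 < \rank V < n)%N /\
        (\rank V)%:R = \sum_j s' j * (\rank (V *m L j))%:R]].
Proof.
move=> d F s01 ik di dk.
(* There are infinitely many subspaces, but a condition depends only on the ranks of [V] and of its
   images, so finitely many constraints remain. The bounds [s i >= 0] and [s k <= 1] are left out,
   as the move increases [s i] and decreases [s k]. *)
pose T := (bool + ('I_n.+1 * {ffun 'I_N -> 'I_n.+1}))%type.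
pose realized (c : 'I_n.+1 * {ffun 'I_N -> 'I_n.+1}) :=
  `[< exists V : 'M[R]_n, \rank V = c.1 /\ forall j, \rank (V *m L j) = c.2 j >].
pose A (c : T) : R := match c with
  | inl true => 1 - s i | inl false => s k
  | inr c => if realized c then \sum_j s j * (c.2 j)%:R - c.1%:R else 0 end.
pose B (c : T) : R := match c with
  | inl true => d k | inl false => d i
  | inr c => if realized c then d i * (c.2 k)%:R - d k * (c.2 i)%:R else 0 end.
have A0 c : 0 <= A c.
  case: c => [[]|c] /=; first by rewrite subr_ge0; case/andP: (s01 i).
    by case/andP: (s01 k).
  case: ifP => // /asboolP[V [<- Vj]]; rewrite subr_ge0.
  by rewrite (le_trans (F V))// ler_sum// => j _; rewrite Vj.
have [t t0 [ABt [c [Bc ABc]]]] := max_step A0 (ex_intro (fun c => 0 < B c) (inl true) dk).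
exists t => // s'.
have s'i : s' i = s i + t * d k by rewrite /s' /shift_exponents eqxx (negbTE ik)/=; ring.
have s'k : s' k = s k - t * d i.
  by rewrite /s' /shift_exponents eqxx [k == i]eq_sym (negbTE ik)/=; ring.
split.
- move=> V; rewrite sum_shift_exponents -subr_ge0.
  have lt j : (\rank (V *m L j) < n.+1)%N.
    by rewrite ltnS (leq_trans (mxrankM_maxl _ _))// rank_leq_row.
  pose c' : 'I_n.+1 * {ffun 'I_N -> 'I_n.+1} :=
    (inord (\rank V), [ffun j => Ordinal (lt j)]).
  have c'1 : c'.1 = \rank V :> nat by rewrite /= inordK// ltnS rank_leq_row.
  have c'2 j : c'.2 j = \rank (V *m L j) :> nat by rewrite ffunE.
  have := ABt (inr c'); rewrite /A /B ifT; last first.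
    by apply/asboolP; exists V; split=> // j; rewrite c'2.
  rewrite ifT; last by apply/asboolP; exists V; split=> // j; rewrite c'2.
  rewrite c'1 !c'2 (eq_bigr (fun j => s j * (\rank (V *m L j))%:R)); last first.
    by move=> j _; rewrite c'2.
  set X := \sum_j _ => h; rewrite (_ : _ - _ = X - (\rank V)%:R -
    t * (d i * (\rank (V *m L k))%:R - d k * (\rank (V *m L i))%:R))//.
  by ring.
- move=> j; have [->|ji] := eqVneq j i.
    have := ABt (inl true); rewrite /A /B s'i => h.
    have /andP[h0 _] := s01 i; have tk : 0 <= t * d k by rewrite mulr_ge0// ltW.
    by apply/andP; split; lra.
  have [->|jk] := eqVneq j k.
    have := ABt (inl false); rewrite /A /B s'k => h.
    have /andP[_ h0] := s01 k; have tk : 0 <= t * d i by rewrite mulr_ge0// ltW.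
    by apply/andP; split; lra.
  by rewrite /s' /shift_exponents (negbTE ji) (negbTE jk) !mulr0 subrr mulr0 addr0.
case: c Bc ABc => [[]|c] /=.
- by move=> _ h; apply: Or31; rewrite s'i; lra.
- by move=> _ h; apply: Or32; rewrite s'k; lra.
case: ifP => [/asboolP[V [V1 Vj]]|]; last by rewrite ltxx.
move=> Bc ABc; apply: Or33; exists V; split; last first.
  rewrite sum_shift_exponents V1 !Vj; under eq_bigr do rewrite Vj.
  by move: ABc; set X := \sum_j _ => ABc; lra.
apply/andP; split.
  rewrite lt0n mxrank_eq0; apply/eqP => V0; move: Bc.
  by rewrite -!Vj V0 !mul0mx !mxrank0 => h; lra.
rewrite ltn_neqAle rank_leq_row andbT; apply/eqP => Vfull; move: Bc.
have Vf : row_full V by apply/eqP.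
by rewrite -!Vj !(eqmxMfull _ Vf) /d => h; lra.
Qed.

End polytope.

(** * The discrete inequality for feasible exponents *)

Section discrete_theorem.
Context {R : realType}.

Definition fractional N (s : 'I_N -> R) := [set j | (s j != 0) && (s j != 1)]%SET.

(** If a nonzero [x] were killed by every [L j] with [s j = 1], the condition for the line of [x]
    would bound 1 by the only fractional exponent, or by 0. *)
Lemma discrete_bound_few_fractional N n (m : 'I_N -> nat) (L : forall j, 'M[R]_(n, m j)) s :
  feasible L s -> (forall j, 0 <= s j <= 1) -> (#|fractional s| <= 1)%N -> discrete_bound L s.
Proof.
move=> F s01 few; have s0 j : 0 <= s j by case/andP: (s01 j).
apply: (@discrete_bound_inj _ _ _ _ _ _ (fun j => s j == 1)) => // [j /eqP//|x x0].
apply/eqP/negPn/negP => xn0.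
have := feasible_rect F x; rewrite rank_rV xn0 leNgt => /negP; apply.
have term0 j : j \notin fractional s -> s j * (\rank (x *m L j))%:R = 0.
  rewrite inE negb_and !negbK => /orP[/eqP->|/x0 ->]; first by rewrite mul0r.
  by rewrite mxrank0 mulr0.
have [k kfree|nofree] := pickP (mem (fractional s)); last first.
  by rewrite big1 ?ltr01// => j _; rewrite term0//; move: (nofree j) => /= ->.
rewrite (bigD1 k)//= [X in _ + X]big1 ?addr0; last first.
  move=> j jk; apply: term0; apply: contra jk => jfree.
  by apply/eqP; move/card_le1P: few => /(_ k kfree j); rewrite jfree inE => /esym/eqP.
have sk1 : s k < 1.
  have : k \in fractional s := kfree.
  by rewrite inE lt_neqAle => /andP[_ ->] /=; case/andP: (s01 k).
apply: le_lt_trans sk1; rewrite -[leRHS]mulr1 ler_wpM2l// lern1.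
exact: rank_leq_row.
Qed.

(** Strong induction on the dimension and, within it, on the number of fractional exponents. *)
Theorem feasible_discrete_bound N n (m : 'I_N -> nat) (L : forall j, 'M[R]_(n, m j)) s :
  feasible L s -> (forall j, 0 <= s j <= 1) -> discrete_bound L s.
Proof.
have [q nq] := ubnP n; elim: q => // q IHn in n m L s nq *.
have [f ff] := ubnP #|fractional s|; elim: f => // f IHf in s ff *.
move=> F s01; have s0 j : 0 <= s j by case/andP: (s01 j).
have [few|many] := leqP #|fractional s| 1; first exact: discrete_bound_few_fractional.
have sub s' : feasible L s' -> (forall j, 0 <= s' j <= 1) ->
    (#|fractional s'| < #|fractional s|)%N \/ (exists V : 'M[R]_n, (0 < \rank V < n)%N /\
      (\rank V)%:R = \sum_j s' j * (\rank (V *m L j))%:R) -> discrete_bound L s'.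
  move=> F' s'01 [lt|[V [/andP[V0 Vn] crit]]].
    by apply: IHf => //; apply: leq_trans lt _.
  have s'0 j : 0 <= s' j by case/andP: (s'01 j).
  apply: (discrete_bound_critical (V := V)) => //; apply: IHn => //.
  - by apply: leq_trans Vn _.
  - exact: feasible_sub.
  - rewrite mxrank_compl -ltnS; apply: leq_trans nq.
    by rewrite ltnS ltn_subrL V0 (leq_trans V0)// ltnW.
  - exact: feasible_quotient.
(* If [L i = 0], lowering [s i] to 0 leaves the condition unchanged and only strengthens the
   bound. *)
have drop i : i \in fractional s -> \rank (L i) = 0%N -> discrete_bound L s.
  move=> ifree Li0; pose s' j := if j == i then 0 else s j.
  apply: (@discrete_bound_antitone _ _ _ _ _ _ s').
    by move=> j; rewrite /s'; case: eqP; rewrite ?lexx s0.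
  apply: sub.
  - move=> V; apply: le_trans (F V) _; apply: ler_sum => j _.
    rewrite /s'; case: eqP => // ->; rewrite mul0r.
    rewrite (_ : \rank _ = 0%N) ?mulr0//; apply/eqP.
    by rewrite -leqn0 -Li0 mxrankM_maxr.
  - by move=> j; rewrite /s'; case: eqP => // _; rewrite lexx ler01.
  - left; apply: proper_card; apply/properP; split.
      by apply/fintype.subsetP => j; rewrite !inE /s'; case: (eqVneq j i) => //; rewrite eqxx.
    by exists i => //; rewrite inE /s' !eqxx.
move/card_gt1P: many => [i [k [ifree kfree ik]]].
have [|Li] := posnP (\rank (L i)); first exact: drop.
have [|Lk] := posnP (\rank (L k)); first exact: drop.
have move_good i' k' : i' \in fractional s -> k' \in fractional s -> i' != k' ->
    (0 < \rank (L i'))%N -> (0 < \rank (L k'))%N ->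
    exists2 t, 0 <= t & let s' := shift_exponents s i' k' (\rank (L k'))%:R (\rank (L i'))%:R t in
      (forall j, 0 <= s' j) /\ discrete_bound L s'.
  move=> i'f k'f i'k' Li' Lk'.
  have [||t t0 [F' s'01 tight]] := feasible_move F s01 i'k'; rewrite ?ltr0n//.
  exists t => //; set s' := shift_exponents _ _ _ _ _ _ in F' s'01 tight *.
  split; first by move=> j; case/andP: (s'01 j).
  have s'E j : j != i' -> j != k' -> s' j = s j.
    by move=> /negbTE ji /negbTE jk; rewrite /s' /shift_exponents ji jk !mulr0 subrr mulr0 addr0.
  have fewer j : j \in fractional s -> s' j = 0 \/ s' j = 1 ->
      (#|fractional s'| < #|fractional s|)%N.
    move=> jf s'j; apply: proper_card; apply/properP; split.
      apply/fintype.subsetP => l; have [->//|li] := eqVneq l i'.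
      by have [->//|lk] := eqVneq l k'; rewrite !inE s'E.
    by exists j => //; rewrite inE; case: s'j => ->; rewrite eqxx ?andbF.
  apply: sub => //; case: tight => [h|h|h]; last by right.
  - by left; apply: (fewer i') => //; right.
  - by left; apply: (fewer k') => //; left.
have [t1 t10 [s10 g1]] := move_good i k ifree kfree ik Li Lk.
have ki : k != i by rewrite eq_sym.
have [t2 t20 [s20 g2]] := move_good k i kfree ifree ki Lk Li.
have shift0 i' k' x y : shift_exponents s i' k' x y 0 = s.
  by apply/funext => j; rewrite /shift_exponents mul0r addr0.
(* A move of length 0 ends at [s] itself, whose bound is then at hand. *)
have [t1e|t1n] := eqVneq t1 0; first by move: g1; rewrite t1e shift0.
have [t2e|t2n] := eqVneq t2 0; first by move: g2; rewrite t2e shift0.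
have t1p : 0 < t1 by rewrite lt_def t1n.
have t2p : 0 < t2 by rewrite lt_def t2n.
(* The two end points lie on one line, on opposite sides of [s], at parameters [t1] and [t2]; their
   weights are inversely proportional to these. *)
apply: (discrete_bound_convex (theta := t2 / (t1 + t2)) _ s10 s20 _ g1 g2).
  by rewrite divr_gt0 ?addr_gt0//= ltr_pdivrMr ?addr_gt0// mul1r ltrDr.
move=> j; rewrite /shift_exponents; have := addr_gt0 t1p t2p => /lt0r_neq0 t12.
by field.
Qed.

End discrete_theorem.

(** * Lebesgue measure on row vectors *)

Section translation.
Context {R : realType}.
Local Open Scope ereal_scope.

Lemma lebesgue_measure_shift (t : R) (A : set (measurableTypeR R)) : measurable A ->
  lebesgue_measure ((fun x : measurableTypeR R => x + t : measurableTypeR R)%R @^-1` A)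
  = lebesgue_measure A.
Proof.
move=> mA.
have mphi : measurable_fun setT (fun x : measurableTypeR R => (x + t)%R : measurableTypeR R).
  by apply: measurable_funD => //; exact: measurable_cst.
pose phi : {mfun measurableTypeR R >-> measurableTypeR R} :=
  HB.pack (fun x : measurableTypeR R => (x + t)%R : measurableTypeR R)
    (isMeasurableFun.Build _ _ _ _ _ mphi).
apply/esym; apply: (lebesgue_measure_unique (mu := pushforward lebesgue_measure phi)) mA.
move=> _ [[a b]] _ <-; rewrite /pushforward.
rewrite [X in _ = lebesgue_measure X](_ : _ = `](a - t)%R, (b - t)%R]%classic); last first.
  by apply/seteqP; split => x /=; rewrite !in_itv/= ltrBlDr lerBrDr.
rewrite !lebesgue_measure_itv/= !lte_fin ltrD2r.
by case: ifP => // _; rewrite -!EFinB; congr (_%:E); lra.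
Qed.

Lemma measurable_shift_rV n (t : 'rV[R]_n) :
  measurable_fun setT (fun x : borel_rV n => (x : 'rV[R]_n) + t : borel_rV n)%R.
Proof.
apply: measurable_fun_coord => i.
under eq_fun do rewrite mxE.
by apply: measurable_funD; [exact: measurable_coord | exact: measurable_cst].
Qed.

(** Induction on [n]: [row_cons] turns a translation into a translation of each factor, and a
    product measure is determined by its values on rectangles. *)
Lemma borel_lebesgue_rV_shift n (t : 'rV[R]_n) (A : set (borel_rV n)) : measurable A ->
  borel_lebesgue_rV n ((fun x : borel_rV n => (x : 'rV[R]_n) + t : borel_rV n)%R @^-1` A)
  = borel_lebesgue_rV n A.
Proof.
elim: n t A => [|n IH] t A mA.
  congr (borel_lebesgue_rV 0 _); apply/seteqP; split => x /=;
  by rewrite (_ : (x : 'rV[R]_0) + t = x)%R//; apply/rowP => -[].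
pose t0 := t ord0 (@lshift 1 n ord0); pose t' : 'rV[R]_n := rsubmx (t : 'rV[R]_(1 + n)).
pose tau (p : measurableTypeR R * @borel_rV R n) : measurableTypeR R * @borel_rV R n :=
  ((p.1 + t0)%R : measurableTypeR R, ((p.2 : 'rV[R]_n) + t')%R : borel_rV n).
have mtau : measurable_fun setT tau.
  apply/measurable_fun_pairP; split.
    by apply: measurable_funD; [exact: measurable_fst|exact: measurable_cst].
  exact: measurableT_comp (measurable_shift_rV t') measurable_snd.
pose phi : {mfun (measurableTypeR R * @borel_rV R n)%type >->
    (measurableTypeR R * @borel_rV R n)%type} :=
  HB.pack tau (isMeasurableFun.Build _ _ _ _ _ mtau).
have row_consD p : ((row_cons p : 'rV[R]_n.+1) + t)%R = row_cons (tau p) :> 'rV[R]_(1 + n).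
  rewrite /row_cons/=; apply/rowP => i; rewrite !mxE.
  have [j ->|j ->] := @split_ordP 1 n i.
    by rewrite !mxE !ord1 !eqxx !mulr1n.
  by rewrite !mxE.
rewrite /= /row_cons_measure /pushforward.
have mX : measurable (@row_cons R n @^-1` A).
  by rewrite -[X in measurable X]setTI; exact: measurable_row_cons.
rewrite [RHS](product_measure_unique
  (m' := pushforward (lebesgue_measure \x borel_lebesgue_rV n) phi)) //.
  rewrite /pushforward; congr (product_measure1 _ _ _).
  by apply/funext => p; congr A; exact: row_consD.
move=> B C mB mC; transitivity (
  lebesgue_measure ((fun x : measurableTypeR R => x + t0 : measurableTypeR R)%R @^-1` B) *
  borel_lebesgue_rV n ((fun x : borel_rV n => (x : 'rV[R]_n) + t' : borel_rV n)%R @^-1` C)).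
  apply: product_measure1E.
    rewrite -[X in measurable X]setTI.
    by apply: measurable_funD => //; exact: measurable_cst.
  by rewrite -[X in measurable X]setTI; exact: measurable_shift_rV.
by rewrite lebesgue_measure_shift// IH.
Qed.

Lemma measurable_box n (B : 'I_n -> set (measurableTypeR R)) :
  (forall i, measurable (B i)) ->
  measurable ([set x | forall i, B i ((x : 'rV[R]_n) ord0 i)] : set (borel_rV n)).
Proof.
move=> mB; rewrite (_ : [set _ | _] = \bigcap_(i in [set: 'I_n])
    ((fun x : borel_rV n => (x : 'rV[R]_n) ord0 i) @^-1` B i)).
  apply: fin_bigcap_measurable; first exact: finite_finset.
  by move=> i _; rewrite -[X in measurable X]setTI; exact: measurable_coord.
by apply/seteqP; split => x /= h i => [_|]; exact: h.
Qed.

Lemma lebesgue_rV_borelE n (A : set (@borel_rV R n)) : measurable A ->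
  lebesgue_rV R n A = borel_lebesgue_rV n A.
Proof. exact: measurable_mu_extE. Qed.

Lemma borel_lebesgue_measurable n (A : set (@borel_rV R n)) : measurable A ->
  measurable (A : set (lebesgue_rVType R n)).
Proof. exact: caratheodory_measurable_mu_ext. Qed.

End translation.

Section cubes.
Context {R : realType}.

Definition unit_box n (c : 'rV[R]_n) : set 'rV[R]_n :=
  [set y | forall i, (`[c ord0 i, c ord0 i + 1[%classic : set (measurableTypeR R)) (y ord0 i)].

Lemma measurable_unit_box n (c : 'rV[R]_n) : measurable (unit_box c : set (@borel_rV R n)).
Proof.
apply: (@measurable_box R n (fun i => `[c ord0 i, c ord0 i + 1[%classic)) => i.
exact: measurable_itv.
Qed.

Lemma lebesgue_unit_box n (c : 'rV[R]_n) : lebesgue_rV R n (unit_box c) = 1%E.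
Proof.
rewrite (@lebesgue_rV_prod R n (fun i => `[c ord0 i, c ord0 i + 1[%classic)) => [|i];
  last exact: measurable_itv.
rewrite big1// => i _; rewrite lebesgue_measure_itv/= lte_fin ltrDl ltr01.
by rewrite -EFinB; congr (_%:E); lra.
Qed.

Definition cube n (k : 'rV[int]_n) : set 'rV[R]_n := [set x | floorv x = k].

Lemma cubeE n (k : 'rV[int]_n) : cube k = unit_box k%:V.
Proof.
apply/seteqP; split=> x /=.
  by move=> <- i; rewrite !mxE /= in_itv/=; have := floor_itv (x ord0 i); rewrite intrD.
move=> h; apply/rowP => i; rewrite mxE; apply: floor_def.
by have := h i; rewrite mxE /= in_itv/= intrD.
Qed.

Lemma measurable_cube n (k : 'rV[int]_n) : measurable (cube k : set (@borel_rV R n)).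
Proof. by rewrite cubeE; exact: measurable_unit_box. Qed.

Lemma lebesgue_cube n (k : 'rV[int]_n) : lebesgue_rV R n (cube k) = 1%E.
Proof. by rewrite cubeE; exact: lebesgue_unit_box. Qed.

End cubes.

(** * Null sets and surjective linear maps *)

Section nullsets.
Context {R : realType}.
Local Open Scope ereal_scope.

Lemma borel_lebesgue_rVT_gt0 n : 0 < borel_lebesgue_rV n [set: @borel_rV R n].
Proof.
rewrite -lebesgue_rV_borelE//; apply: lt_le_trans (_ : 0 < 1) _; first exact: lte01.
rewrite -(@lebesgue_cube R n 0); apply: le_measure => //; rewrite inE.
  exact: borel_lebesgue_measurable (measurable_cube _).
exact: borel_lebesgue_measurable.
Qed.

Lemma measurable_mulmx_rV n m (M : 'M[R]_(n, m)) :
  measurable_fun setT (fun x : borel_rV n => (x : 'rV[R]_n) *m M : borel_rV m)%R.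
Proof.
apply: measurable_fun_coord => i.
under eq_fun do rewrite mxE.
apply: measurable_sum => k; apply: measurable_funM; first exact: measurable_coord.
exact: measurable_cst.
Qed.

(* Averaging over translates: Fubini for (y, t) |-> 1_B (y M + t) shows that
   almost every translate of B has null preimage, and all preimages of
   translates are translates of the preimage of B. *)
Lemma borel_null_preimage n m (M : 'M[R]_(n, m)) (Q : 'M[R]_(m, n))
    (B : set (@borel_rV R m)) :
  (Q *m M = 1%:M)%R -> measurable B -> borel_lebesgue_rV m B = 0 ->
  borel_lebesgue_rV n ((fun x : borel_rV n => (x : 'rV[R]_n) *m M : borel_rV m)%R @^-1` B) = 0.
Proof.
move=> QM mB B0.
pose phi (p : @borel_rV R n * @borel_rV R m) : @borel_rV R m :=
  ((p.1 : 'rV[R]_n) *m M + (p.2 : 'rV[R]_m))%R.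
have mphi : measurable_fun setT phi.
  apply: measurable_fun_coord => i; under eq_fun do rewrite mxE.
  apply: measurable_funD.
    exact: measurableT_comp (measurable_coord i)
      (measurableT_comp (measurable_mulmx_rV M) measurable_fst).
  exact: measurableT_comp (measurable_coord i) measurable_snd.
have mE : measurable (phi @^-1` B).
  by rewrite -[X in measurable X]setTI; exact: mphi.
have := indic_fubini_tonelli (borel_lebesgue_rV n) (borel_lebesgue_rV m) mE.
rewrite indic_fubini_tonelli_FE// indic_fubini_tonelli_GE//.
rewrite [LHS]integral0_eq; last first.
  move=> y _ /=; rewrite -[RHS]B0.
  rewrite -[RHS](borel_lebesgue_rV_shift (y *m M)%R mB).
  congr (borel_lebesgue_rV m _); apply/seteqP; split => t /=.
    by rewrite /xsection/= inE /phi/= addrC.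
  by rewrite /xsection/= inE /phi/= addrC.
move=> /esym G0.
have : ae_eq (borel_lebesgue_rV m) setT
   (borel_lebesgue_rV n \o ysection (phi @^-1` B)) (cst 0).
  apply/ae_eq_integral_abs => //; first exact: measurable_fun_ysection.
  by rewrite -[RHS]G0; apply: eq_integral => t _; rewrite gee0_abs.
have pos := borel_lebesgue_rVT_gt0 m.
move=> [N [mN N0 subN]].
have [t tN] : exists t, ~ N t.
  apply/not_existsP => h; move: pos.
  rewrite (_ : setT = N) ?N0 ?ltxx//.
  by apply/seteqP; split => // x _; apply: contrapT; exact: h.
have : borel_lebesgue_rV n (ysection (phi @^-1` B) t) = 0.
  by apply: contrapT => h; apply: tN; apply: subN => /= /(_ I).
move=> <-.
have mpre : measurable ((fun x : borel_rV n => (x : 'rV[R]_n) *m M : borel_rV m)%R @^-1` B).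
  by rewrite -[X in measurable X]setTI; exact: measurable_mulmx_rV.
(* Since [Q *m M = 1], a point [y] lies in the section at [t] exactly when [y + t *m Q] lies in the
   preimage of [B]. *)
rewrite -[LHS](borel_lebesgue_rV_shift (t *m Q)%R mpre).
by congr (borel_lebesgue_rV n _); apply/seteqP; split => y /=;
  rewrite /ysection/= inE /phi/= mulmxDl -mulmxA QM mulmx1.
Qed.

(** [lebesgue_rV] is an outer measure, an infimum over countable Borel covers; covers of measure at
    most [1 / (q + 1)] are intersected over all [q]. *)
Lemma lebesgue_null_borel n (N : set (lebesgue_rVType R n)) :
  lebesgue_rV R n N = 0 -> exists B : set (@borel_rV R n),
    [/\ measurable B, N `<=` B & borel_lebesgue_rV n B = 0].
Proof.
move=> N0.
have /choice[F HF] q : exists F : (set (@borel_rV R n))^nat,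
    [/\ forall k, measurable (F k), N `<=` \bigcup_k F k &
     borel_lebesgue_rV n (\bigcup_k F k) <= (q.+1%:R^-1)%:E].
  have : lebesgue_rV R n N < (q.+1%:R^-1)%:E by rewrite N0 lte_fin invr_gt0.
  move=> /ereal_inf_lt[_ [F [mF NF] <-] lt]; exists F; split => //.
  apply: le_trans (ltW lt); apply: measure_sigma_subadditive => //.
  exact: bigcup_measurable.
exists (\bigcap_q \bigcup_k F q k); split.
- apply: bigcap_measurable => // q _; apply: bigcup_measurable => k _.
  by have [] := HF q.
- by move=> x Nx q _; have [_ + _] := HF q; apply.
apply/eqP; rewrite eq_le measure_ge0 andbT; apply/lee_addgt0Pr => e e0.
rewrite add0e.
have [q qe] : exists q, (q.+1%:R^-1 < e)%R.
  exists (Num.bound e^-1); rewrite invf_plt ?posrE//.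
  rewrite (lt_trans (archi_boundP _))// ?invr_ge0 ?(ltW e0)// ltr_nat//.
have [mF _ le] := HF q.
apply: le_trans (le_trans le _); last by rewrite lee_fin ltW.
apply: le_measure; rewrite ?inE.
- by apply: bigcap_measurable => // q' _; apply: bigcup_measurable => k _; have [] := HF q'.
- exact: bigcup_measurable.
- by move=> x; apply.
Qed.

(** The exceptional set is first enlarged to a Borel null set, whose preimage is Borel and null. *)
Lemma ae_preimage n m (M : 'M[R]_(n, m)) (Q : 'M[R]_(m, n)) (P : 'rV[R]_m -> Prop) :
  (Q *m M = 1%:M)%R -> {ae lebesgue_rV R m, forall x, P x} ->
  {ae lebesgue_rV R n, forall y, P (y *m M)%R}.
Proof.
move=> QM [N [mN N0 subN]]; have [B [mB NB B0]] := lebesgue_null_borel N0.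
have mpre : measurable ((fun x : borel_rV n => (x : 'rV[R]_n) *m M : borel_rV m)%R @^-1` B).
  by rewrite -[X in measurable X]setTI; exact: measurable_mulmx_rV.
exists ((fun x : borel_rV n => (x : 'rV[R]_n) *m M : borel_rV m)%R @^-1` B); split.
- exact: borel_lebesgue_measurable.
- by rewrite lebesgue_rV_borelE// (borel_null_preimage QM).
- by move=> y /= nP; apply: NB; apply: subN.
Qed.

End nullsets.

(** * Bounding integrals by sums over cubes *)

Section integral_bounds.
Context {R : realType}.
Local Open Scope ereal_scope.

(* The integral of a nonnegative function, measurable or not, is a supremum over
   the simple functions below it. *)
Lemma le_integral_ge0 d (T : measurableType d) (mu : {measure set T -> \bar R})
    (f g : T -> \bar R) : (forall x, 0 <= f x) -> (forall x, f x <= g x) ->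
  \int[mu]_x f x <= \int[mu]_x g x.
Proof.
move=> f0 fg; rewrite !ge0_integralTE//; last by move=> x; exact: le_trans (fg x).
apply: ereal_sup_le => _ [h hf <-]; exists h => // x.
exact: le_trans (hf x) (fg x).
Qed.

(** [F] is dominated everywhere by the step function [h] plus a function equal to [+oo] on a null
    set. The latter has integral 0, and the former integrates to the sum of [H], as cubes have
    measure 1. *)
Lemma integral_cubes_le n (F : 'rV[R]_n -> R) (H : 'rV[int]_n -> R) (M : R) :
  (forall y, 0 <= F y)%R -> (forall k, 0 <= H k)%R ->
  {ae lebesgue_rV R n, forall y, (F y <= H (floorv y))%R} ->
  (forall s, uniq s -> \sum_(k <- s) H k <= M)%R ->
  \int[lebesgue_rV R n]_y (F y)%:E <= M%:E.
Proof.
move=> F0 H0 [N [mN N0 subN]] HM.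
pose h (y : lebesgue_rVType R n) := (H (floorv (y : 'rV[R]_n)))%:E.
(* The cubes are enumerated by [nat] through [pickle_inv]; a number that encodes no lattice point
   gives the empty set. *)
pose U (i : nat) : set (lebesgue_rVType R n) :=
  if @pickle_inv 'rV[int]_n i is Some k then cube k else set0.
have mU i : measurable (U i).
  rewrite /U; case: pickle_inv => [k|//].
  exact: borel_lebesgue_measurable (measurable_cube k).
have UT : \bigcup_i U i = setT.
  apply/seteqP; split => // y _; exists (pickle (floorv (y : 'rV[R]_n))) => //.
  by rewrite /U pickleK_inv.
have mh : measurable_fun setT h.
  move=> _ Y mY; rewrite setTI.
  (* [h] is constant on each cube, so every preimage is a countable union of cubes. *)
  rewrite (_ : _ @^-1` _ = \bigcup_(i in [set i | exists2 y, U i y & Y (h y)]) U i).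
    by apply: bigcup_measurable => i _.
  apply/seteqP; split=> y /=.
    move=> Yy; have : [set: lebesgue_rVType R n] y by [].
    by rewrite -UT => -[i _ Uy]; exists i => //=; exists y.
  move=> [i [y' Uy' Yy'] Uy]; move: Yy' Uy' Uy; rewrite /U.
  case: pickle_inv => // k; rewrite /cube /h/= => + y'k yk.
  by rewrite y'k yk.
have h0 y : 0 <= h y by rewrite lee_fin.
have moo : measurable_fun setT ((cst +oo : lebesgue_rVType R n -> \bar R) \_ N).
  by apply/(measurable_restrictT _ mN).
have oo0 y : 0 <= ((cst +oo : lebesgue_rVType R n -> \bar R) \_ N) y.
  by rewrite patchE; case: ifP => // _; rewrite leey.
apply: (@le_trans _ _ (\int[lebesgue_rV R n]_y
    (h y + ((cst +oo : lebesgue_rVType R n -> \bar R) \_ N) y))).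
  apply: le_integral_ge0 => y; first by rewrite lee_fin.
  rewrite patchE; case: ifPn => [_|yN]; first by rewrite addey// leey.
  rewrite adde0 lee_fin; apply: contrapT => nle; move/negP: yN; apply.
  apply/mem_set; exact: subN nle.
rewrite ge0_integralD// -[X in _ + X]integral_mkcond integral_cst//.
rewrite [X in _ + _ * X](_ : _ = 0) ?mule0 ?adde0; last exact: N0.
rewrite -UT ge0_integral_bigcup//; last 2 first.
- by rewrite UT.
- apply/trivIsetP => i j _ _ ij; apply/seteqP; split => // y [].
  rewrite /U; case E: pickle_inv => [k|//]; case E': pickle_inv => [k'|//].
  rewrite /cube/= => yk yk'; move/negP: ij; apply; apply/eqP.
  have := @pickle_invK 'rV[int]_n i; have := @pickle_invK 'rV[int]_n j.
  by rewrite E E' /= -yk -yk' => <- <-.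
have intU i : \int[lebesgue_rV R n]_(y in U i) h y =
    (oapp H 0%R (@pickle_inv 'rV[int]_n i))%:E.
  rewrite /U; case: pickle_inv => [k|] /=; last by rewrite integral_set0.
  rewrite (eq_integral (cst (H k)%:E)); last first.
    by move=> y; rewrite inE /cube/= /h => ->.
  rewrite integral_cst; last exact: borel_lebesgue_measurable (measurable_cube k).
  by rewrite [X in _ * X](_ : _ = 1) ?mule1//; exact: lebesgue_cube.
under eq_eseriesr do rewrite intU.
apply: lime_le.
  apply: is_cvg_nneseries => i _ _; rewrite lee_fin.
  by case: pickle_inv => /=.
apply: nearW => K; rewrite sumEFin lee_fin.
rewrite (_ : (\sum_(0 <= i < K) _)%R =
   (\sum_(k <- pmap (@pickle_inv 'rV[int]_n) (index_iota 0 K)) H k)%R).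
  by apply: HM; apply: (pmap_uniq (@pickle_invK 'rV[int]_n)); exact: iota_uniq.
by rewrite big_pmap.
Qed.

End integral_bounds.

(** * Sufficiency *)

Section bridge.
Context {R : realType}.

(** Links [{vspace}] subspaces to row spaces: the rows of [A] span the same space as those of
    [row_base A], which are free. *)
Lemma dim_span_rows k n (A : 'M[R]_(k, n)) :
  \dim <<[seq row i A | i <- enum 'I_k]>>%VS = \rank A.
Proof.
have span_sub k1 k2 (A1 : 'M[R]_(k1, n)) (A2 : 'M[R]_(k2, n)) : (A1 <= A2)%MS ->
    (<<[seq row i A1 | i <- enum 'I_k1]>> <= <<[seq row i A2 | i <- enum 'I_k2]>>)%VS.
  move=> /submxP[D ->]; apply/span_subvP => _ /mapP[i _ ->].
  rewrite row_mul mulmx_sum_row memv_suml// => j _; apply: memvZ; apply: memv_span.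
  by apply: map_f; rewrite mem_enum.
have -> : <<[seq row i A | i <- enum 'I_k]>>%VS =
          <<[seq row i (row_base A) | i <- enum 'I_(\rank A)]>>%VS.
  apply/eqP; rewrite eqEsubv !span_sub//; first by rewrite eq_row_base.
  by rewrite -(eq_row_base A).
pose X := [tuple row i (row_base A) | i < \rank A].
have -> : [seq row i (row_base A) | i <- enum 'I_(\rank A)] = X.
  by rewrite -[in LHS]val_ord_tuple.
have fX : free X.
  apply/freeP => c c0 i; pose v := \row_j c j.
  have vB : v *m row_base A = 0.
    rewrite mulmx_sum_row -[RHS]c0; apply: eq_bigr => j _.
    by rewrite mxE nth_mktuple.
  have : v = 0 by apply: (row_free_inj (row_base_free A)); rewrite vB mul0mx.
  by move/rowP => /(_ i); rewrite !mxE.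
by move/eqP: fX => ->; rewrite size_tuple.
Qed.

Lemma limg_span_rows k n m (A : 'M[R]_(k, n)) (l : 'Hom('rV[R]_n, 'rV[R]_m)) :
  (l @: <<[seq row i A | i <- enum 'I_k]>>)%VS =
  <<[seq row i (A *m lin1_mx l) | i <- enum 'I_k]>>%VS.
Proof.
rewrite limg_span -map_comp; congr <<_>>%VS; apply: eq_map => i /=.
by rewrite row_mul mul_rV_lin1.
Qed.

Lemma vspace_rows n (V : {vspace 'rV[R]_n}) : exists k (A : 'M[R]_(k, n)),
  V = <<[seq row i A | i <- enum 'I_k]>>%VS.
Proof.
exists (\dim V), (\matrix_i (vbasis V)`_i); rewrite -{1}(span_basis (vbasisP V)).
congr <<_>>%VS; apply: (@eq_from_nth _ 0).
  by rewrite size_tuple size_map size_enum_ord.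
move=> i; rewrite size_tuple => iV.
by rewrite (nth_map (Ordinal iV)) ?size_enum_ord// rowK nth_enum_ord.
Qed.

Lemma surj_section n m (l : 'Hom('rV[R]_n, 'rV[R]_m)) : limg l = fullv ->
  lin1_mx (l^-1)%VF *m lin1_mx l = 1%:M.
Proof.
move=> lsurj; apply/row_matrixP => i.
rewrite row_mul mul_rV_lin1 !rowE mulmx1 mul_rV_lin1/= limg_lfunVK// lsurj.
exact: memvf.
Qed.

End bridge.

(** * Local suprema and amalgam norms *)

Section amalgam_facts.
Context {R : realType}.
Local Open Scope ereal_scope.

Lemma Linfty_Q_ge0 d (f : 'rV[R]_d -> R) k : 0 <= Linfty_Q f k.
Proof. exact: Lnorm_ge0. Qed.

Lemma lebesgue_rVT_gt0 d : 0 < lebesgue_rV R d [set: lebesgue_rVType R d].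
Proof. by rewrite lebesgue_rV_borelE// borel_lebesgue_rVT_gt0. Qed.

Lemma Linfty_QE d (f : 'rV[R]_d -> R) k :
  Linfty_Q f k = ess_sup (lebesgue_rV R d) (abse \o ((EFin \o f) \_ (Qset k))).
Proof.
by rewrite /Linfty_Q unlock /Lnorm ifT//; exact: lebesgue_rVT_gt0.
Qed.

Lemma enorm_le d (x : 'rV[R]_d) (c : R) : (0 <= c)%R -> (`|x| <= c)%R ->
  (enorm x <= c * Num.sqrt d%:R)%R.
Proof.
move=> c0 xc; rewrite -[X in (X * _)%R](ger0_norm c0) -sqrtr_sqr -sqrtrM ?sqr_ge0//.
rewrite ler_wsqrtr// mulr_natr -[X in (_ *+ X)%R]card_ord -sumr_const ler_sum// => i _.
rewrite -[leLHS]real_normK ?num_real// ler_pXn2r ?nnegrE//.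
by rewrite (le_trans (coord_le_norm _ _)).
Qed.

Lemma norm_le_enorm d (x : 'rV[R]_d) : (`|x| <= enorm x)%R.
Proof.
apply/rV_norm_leP => [|i]; first exact: sqrtr_ge0.
rewrite -sqrtr_sqr ler_wsqrtr// (bigD1 i)//= lerDl.
by apply: sumr_ge0 => j _; exact: sqr_ge0.
Qed.

(** The sup distance from [x] to [floorv x] is at most 1, so the Euclidean distance is at most
    [sqrt d], the radius of [Qset]. The null sets of the countably many [Qset k] are merged. *)
Lemma le_Linfty_Q_floor d (f : 'rV[R]_d -> R) : (forall x, 0 <= f x)%R ->
  {ae lebesgue_rV R d, forall x, (f x)%:E <= Linfty_Q f (floorv x)}.
Proof.
move=> f0.
have : {ae lebesgue_rV R d, forall x, forall i,
    if @pickle_inv 'rV[int]_d i is Some k then Qset k x -> (f x)%:E <= Linfty_Q f k else True}.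
  apply: ae_foralln => i; case: pickle_inv => [k|]; last exact: aeW.
  have := ess_sup_ge (lebesgue_rV R d) (abse \o ((EFin \o f) \_ (Qset k))).
  rewrite -Linfty_QE; apply: filterS => x /= h Qx; apply: le_trans h.
  by rewrite patchE mem_set//= lee_fin ler_norm.
move=> [N [mN N0 sub]]; exists N; split => // x /= h; apply: sub => /= /(_ (pickle (floorv x))).
rewrite pickleK_inv => fx; apply: h; apply: fx.
rewrite /Qset/= -[leRHS]mul1r; apply: enorm_le => //.
exact: floorv_dist.
Qed.

Lemma amalgam_norm_ge0 d p (f : 'rV[R]_d -> R) : 0 <= amalgam_norm p f.
Proof.
case: p => [r||] //=; first exact: poweR_ge0.
by apply: le_trans (Linfty_Q_ge0 f 0) _; apply: ereal_sup_ubound; exists 0%R.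
Qed.

Lemma sum_le_amalgam d (r : R) (f : 'rV[R]_d -> R) (s : seq 'rV[int]_d) :
  (0 < r)%R -> uniq s ->
  (\sum_(k <- s) Linfty_Q f k `^ r) `^ r^-1 <= amalgam_norm r%:E f.
Proof.
move=> r0 us; rewrite /amalgam_norm; apply: gt0_ler_poweR.
- by rewrite invr_ge0 ltW.
- by rewrite in_itv/= leey andbT; apply: sume_ge0 => k _; exact: poweR_ge0.
- by rewrite in_itv/= leey andbT; apply: esum_ge0 => k _; exact: poweR_ge0.
rewrite fsbig_seq//; apply: esum_ge; exists [set` s] => //.
by split => //; exact: finite_seq.
Qed.

Lemma Linfty_le_amalgam d p (f : 'rV[R]_d -> R) k : 1 <= p ->
  Linfty_Q f k <= amalgam_norm p f.
Proof.
case: p => [r||]//; last by move=> _; apply: ereal_sup_ubound; exists k.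
rewrite lee_fin => r1; have r0 : (0 < r)%R by apply: lt_le_trans r1.
apply: le_trans (sum_le_amalgam f r0 (s := [:: k]) isT).
rewrite big_seq1 -poweRrM mulfV ?gt_eqF// poweRe1//.
exact: Linfty_Q_ge0.
Qed.

End amalgam_facts.

Section sufficiency.
Context {R : realType}.

Definition inv_exponent (p : \bar R) : R := if p is r%:E then r^-1 else 0.

Lemma inve_inv_exponent (p : \bar R) : (1 <= p)%E -> (p^-1 = (inv_exponent p)%:E)%E.
Proof.
case: p => [r||]//. 
by rewrite lee_fin => r1; rewrite inver gt_eqF// (lt_le_trans _ r1).
Qed.

Lemma inv_exponent01 (p : \bar R) : (1 <= p)%E -> 0 <= inv_exponent p <= 1.
Proof.
case: p => [r||]//=; last by rewrite lexx ler01.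
rewrite lee_fin => r1; have r0 : 0 < r by apply: lt_le_trans r1.
by rewrite invr_ge0 (ltW r0)/= invf_le1.
Qed.

Lemma dim_conditionP N d (dd : 'I_N -> nat)
    (l : forall j, 'Hom('rV[R]_d, 'rV[R]_(dd j))) (p : 'I_N -> \bar R) :
  (forall j, 1 <= p j)%E ->
  (forall V : {vspace 'rV[R]_d},
     (\dim V)%:R%:E <= \sum_(j < N) (p j)^-1 * (\dim (l j @: V)%VS)%:R%:E)%E <->
  feasible (fun j => lin1_mx (l j)) (fun j => inv_exponent (p j)).
Proof.
move=> p1.
have sumE (x : 'I_N -> nat) : (\sum_(j < N) (p j)^-1 * (x j)%:R%:E)%E =
    (\sum_(j < N) inv_exponent (p j) * (x j)%:R)%:E.
  by rewrite -sumEFin; apply: eq_bigr => j _; rewrite inve_inv_exponent.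
split=> [H A|F V].
  have := H <<[seq row i A | i <- enum 'I_d]>>%VS.
  rewrite sumE lee_fin dim_span_rows => /le_trans; apply.
  by apply: ler_sum => j _; rewrite limg_span_rows dim_span_rows.
have [k [A ->]] := vspace_rows V; rewrite sumE lee_fin dim_span_rows.
apply: le_trans (feasible_rect F A) _.
by apply: ler_sum => j _; rewrite limg_span_rows dim_span_rows.
Qed.

(** The discrete inequality indexes the atoms for all [j] by one type; lists of different lengths
    are padded with zero weights up to a common size. *)
Lemma sum_nth_ord (T : eqType) (x0 : T) (K : nat) (s : seq T) (P : pred T) (F : T -> R) :
  (size s <= K)%N ->
  \sum_(i < K | P (nth x0 s i)) (if (i < size s)%N then F (nth x0 s i) else 0) =
  \sum_(x <- s | P x) F x.
Proof.
move=> sK; rewrite (big_nth x0) big_mkord.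
rewrite (big_ord_widen_cond K (fun i => P (nth x0 s i)) (fun i => F (nth x0 s i)))//.
by rewrite big_mkcondr.
Qed.

(* [feasible_discrete_bound] applied to integer points, with the masses
   [a j k `^ r] placed at the integer points [k] when [p j = r%:E]. *)
Lemma lattice_bound N d (dd : 'I_N -> nat) (L : forall j, 'M[R]_(d, dd j))
    (p : 'I_N -> \bar R) (t : nat) : (forall j, 1 <= p j)%E ->
  feasible L (fun j => inv_exponent (p j)) -> exists2 C : R, 0 <= C &
  forall (a : forall j, 'rV[int]_(dd j) -> R) (M : 'I_N -> R)
    (near : forall j, 'rV[int]_d -> seq 'rV[int]_(dd j)),
    (forall j k, 0 <= a j k) -> (forall j, 0 <= M j) ->
    (forall j q, uniq (near j q) /\
       forall k, (k \in near j q) = (`|k%:V - q%:V *m L j| <= t%:R)) ->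
    (forall j s, uniq s ->
       if p j is r%:E then (\sum_(k <- s) a j k `^ r) `^ r^-1 <= M j else true) ->
  forall s, uniq s ->
  \sum_(q <- s) \prod_j (if p j is r%:E then (\sum_(k <- near j q) a j k `^ r) `^ r^-1 else M j)
    <= C * \prod_j M j.
Proof.
move=> p1 F.
have := feasible_discrete_bound F (fun j => inv_exponent01 (p1 j)).
move=> /discrete_bound_homogeneous/(_ t%:R)[C C0 HC]; exists C => // a M near a0 M0 nearP aM s us.
pose S j := undup (flatten [seq near j q | q <- s]).
pose K := \max_j size (S j).
have SK j : (size (S j) <= K)%N by exact: (leq_bigmax j).
pose pw j k : R := if p j is r%:E then a j k `^ r else 0.
pose z j (i : 'I_K) := (nth 0 (S j) i)%:V : 'rV[R]_(dd j).
pose w j (i : 'I_K) := if (i < size (S j))%N then pw j (nth 0 (S j) i) else 0.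
have pw0 j k : 0 <= pw j k by rewrite /pw; case: (p j) => [r||]//; exact: powR_ge0.
have w0 j i : 0 <= w j i by rewrite /w; case: ifP.
have massE j q : q \in s -> mass (z j) (w j) t%:R (q%:V *m L j) =
    \sum_(k <- near j q) pw j k.
  move=> qs; rewrite /mass /z /w.
  rewrite (sum_nth_ord 0 (fun k : 'rV[int]_(dd j) => `|k%:V - q%:V *m L j| <= t%:R) _ (SK j)).
  rewrite -big_filter; apply: perm_big; apply: uniq_perm.
  - by rewrite filter_uniq// undup_uniq.
  - by case: (nearP j q).
  move=> k; case: (nearP j q) => _ nk; rewrite mem_filter -nk andb_idr// => kn.
  by rewrite mem_undup; apply/flattenP; exists (near j q) => //; exact: map_f.
have totE j : \sum_i w j i = \sum_(k <- S j) pw j k.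
  by rewrite -(sum_nth_ord 0 predT _ (SK j)).
(* Where [p j = +oo] the mass has exponent 0 and contributes 1, so the factor [M j] is taken out
   beforehand. *)
pose c := \prod_j (if p j is r%:E then 1 else M j).
have c0 : 0 <= c by apply: prodr_ge0 => j _; case: (p j).
have sE : \sum_(q <- s) \prod_j (if p j is r%:E then
      (\sum_(k <- near j q) a j k `^ r) `^ r^-1 else M j) =
    c * \sum_(i < size s) 1 *
      \prod_j mass (z j) (w j) t%:R ((nth 0 s i)%:V *m L j) `^ inv_exponent (p j).
  rewrite mulr_sumr (big_nth 0) big_mkord; apply: eq_bigr => i _.
  rewrite mul1r -big_split/=; apply: eq_bigr => j _.
  rewrite massE ?mem_nth// /pw /inv_exponent; case: (p j) (p1 j) => [r||]// _.
    by rewrite mul1r.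
  by rewrite powRr0 mulr1.
rewrite {}sE.
apply: le_trans (ler_wpM2l c0 (HC _ _ (fun i : 'I_(size s) => (nth 0 s i)%:V) (fun=> 1) z w 1
  (fun=> ler01) ler01 _ w0)) _.
  (* Distinct lattice points have distinct floors, so unit weights are sparse. *)
  move=> k; have [i ik|none] :=
      pickP (fun i : 'I_(size s) => floorv ((nth 0 s i)%:V : 'rV[R]_d) == k);
    last by rewrite big_pred0// ler01.
  rewrite (big_pred1 i)// => i'; apply/idP/eqP => [/eqP|-> //].
  move/eqP: ik => <-; rewrite !floorv_int => /eqP.
  by rewrite nth_uniq// => /eqP/val_inj.
rewrite mulr1 mulrCA ler_wpM2l// -big_split/=; apply: ler_prod => j _.
rewrite totE /pw /inv_exponent; have := aM j (S j) (undup_uniq _).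
case: (p j) (p1 j) => [r||]// _ h; first by rewrite mul1r powR_ge0 h.
by rewrite powRr0 mulr1 M0 lexx.
Qed.

End sufficiency.

(** * The integral bound from the lattice bound *)

Section sufficiency_integral.
Context {R : realType}.
Local Open Scope ereal_scope.

Lemma ae_forall_ord N d (P : 'I_N -> 'rV[R]_d -> Prop) :
  (forall j, {ae lebesgue_rV R d, forall y, P j y}) ->
  {ae lebesgue_rV R d, forall y, forall j, P j y}.
Proof.
move=> aeP.
have : {ae lebesgue_rV R d, forall y, forall i : nat, forall j : 'I_N, val j = i -> P j y}.
  apply: ae_foralln => i; have [j ji|none] := pickP (fun j : 'I_N => val j == i).
    have [A [mA A0 sub]] := aeP j; exists A; split => // y /= h; apply: sub => /= Pjy.
    apply: h => j' j'i; rewrite (_ : j' = j)//; apply: val_inj.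
    by rewrite /= in j'i *; rewrite (eqP ji).
  by apply: aeW => y j ji; move: (none j); rewrite ji eqxx.
move=> [A [mA A0 sub]]; exists A; split => // y /= h; apply: sub => /= h'.
by apply: h => j; exact: h' (val j) j erefl.
Qed.

Lemma prode_gt0 N (x : 'I_N -> \bar R) (P : pred 'I_N) : (forall j, 0 < x j) ->
  0 < \prod_(j | P j) x j.
Proof. by move=> x0; apply: (big_ind (fun x => 0 < x)) => // a b; exact: mule_gt0. Qed.

Lemma prode_eqy N (x : 'I_N -> \bar R) j : (forall j, 0 < x j) -> x j = +oo ->
  \prod_j x j = +oo.
Proof.
by move=> x0 xj; rewrite (bigD1 j)//= xj gt0_mulye//; exact: prode_gt0.
Qed.

(** For almost every [y] in the cube of [q], [f j (l j y)] is at most the local supremum at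
    [floorv (l j y)], a lattice point within [1 + Kb] of the image of [q]. For [p j = r%:E] the
    [l^r] norm of the suprema at all nearby lattice points bounds this value and depends on [q]
    only. *)
Lemma feasible_integral_bound N d (dd : 'I_N -> nat)
    (l : forall j, 'Hom('rV[R]_d, 'rV[R]_(dd j))) (p : 'I_N -> \bar R) :
  (forall j, limg (l j) = fullv) -> (forall j, 1 <= p j) ->
  feasible (fun j => lin1_mx (l j)) (fun j => inv_exponent (p j)) ->
  exists C : R, forall f : (forall j, 'rV[R]_(dd j) -> R),
    (forall j x, (0 <= f j x)%R) ->
    \int[lebesgue_rV R d]_y (\prod_(j < N) f j (l j y))%:E
      <= C%:E * \prod_(j < N) amalgam_norm (p j) (f j).
Proof.
move=> l_surj p1 F.
have [Kb Kb0 HKb] := mulmx_norm_bound_fam (fun j => lin1_mx (l j)).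
pose t := Num.bound (1 + Kb).
have [C C0 HC] := lattice_bound t p1 F.
(* A positive constant makes the right-hand side [+oo] when some norm is infinite and none
   vanishes. *)
exists (C + 1)%R => f f0.
pose A j := amalgam_norm (p j) (f j).
have A0 j : 0 <= A j by exact: amalgam_norm_ge0.
have LA j k : Linfty_Q (f j) k <= A j by exact: Linfty_le_amalgam.
have F0 y : (0 <= \prod_(j < N) f j (l j y))%R by apply: prodr_ge0.
have aeL : {ae lebesgue_rV R d, forall y, forall j,
    (f j (l j y))%:E <= Linfty_Q (f j) (floorv (l j y))}.
  apply: ae_forall_ord => j.
  have := ae_preimage (surj_section (l_surj j)) (le_Linfty_Q_floor (f0 j)).
  move=> [B [mB B0 sub]]; exists B; split => // y /= h; apply: sub => /=.
  by rewrite mul_rV_lin1.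
(* A vanishing norm comes first: one factor is then 0 almost everywhere, and the right-hand side is
   0 even if another norm is infinite. *)
have [j /eqP Aj0|Apos] := pickP (fun j => A j == 0).
  rewrite [leRHS](_ : _ = 0%:E); last first.
    by rewrite (bigD1 j)//= -/(A j) Aj0 mul0e mule0.
  apply: (@integral_cubes_le _ _ (fun y => \prod_(j < N) f j (l j y))%R (fun=> 0%R) 0%R) => //;
    last first.
    by move=> s _; rewrite big1.
  move: aeL => [B [mB B0 sub]]; exists B; split => // y /= h; apply: sub => /= fL.
  apply: h; rewrite (bigD1 j)//=; have := le_trans (fL j) (LA j _).
  rewrite Aj0 lee_fin => fj0; rewrite (_ : f j _ = 0%R) ?mul0r//.
  by apply/eqP; rewrite eq_le fj0 f0.
have {}Apos j : 0 < A j by rewrite lt_def Apos A0.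
have [j /eqP Ajy|Afin] := pickP (fun j => A j == +oo).
  rewrite (prode_eqy Apos Ajy) gt0_muley ?leey// lte_fin.
  by rewrite (lt_le_trans ltr01)// lerDr.
have {}Afin j : A j \is a fin_num.
  by rewrite ge0_fin_numE ?A0// lt_neqAle Afin leey.
have Lfin j k : Linfty_Q (f j) k \is a fin_num.
  rewrite ge0_fin_numE ?Linfty_Q_ge0//; apply: le_lt_trans (LA j k) _.
  by rewrite -ge0_fin_numE ?Afin.
pose a j k := fine (Linfty_Q (f j) k).
have aE j k : Linfty_Q (f j) k = (a j k)%:E by rewrite /a fineK.
have a0 j k : (0 <= a j k)%R by rewrite fine_ge0 ?Linfty_Q_ge0.
pose near j (q : 'rV[int]_d) := sval (cid (near_int t (q%:V *m lin1_mx (l j))%R)).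
have nearP j q : uniq (near j q) /\
    forall k : 'rV[int]_(dd j), (k \in near j q) = (`|k%:V - q%:V *m lin1_mx (l j)| <= t%:R)%R.
  by rewrite /near; case: cid => s /= [].
pose H q := (\prod_j (if p j is r%:E then
    (\sum_(k <- near j q) a j k `^ r) `^ r^-1 else fine (A j)))%R.
have r_gt0 j r : p j = r%:E -> (0 < r)%R.
  by move=> pj; have := p1 j; rewrite pj lee_fin; exact: lt_le_trans.
have aA j s : uniq s ->
    if p j is r%:E then ((\sum_(k <- s) a j k `^ r) `^ r^-1 <= fine (A j))%R else true.
  move=> us; case pj : (p j) => [r||]//.
  rewrite -lee_fin fineK// /A pj.
  apply: le_trans (sum_le_amalgam (f j) (r_gt0 _ _ pj) us).
  rewrite -poweR_EFin -sumEFin le_eqVlt; apply/orP; left; apply/eqP; congr (_ `^ _).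
  by apply: eq_bigr => k _; rewrite aE poweR_EFin.
rewrite (_ : \prod_(j < N) _ = (\prod_(j < N) fine (A j))%:E); last first.
  by rewrite -prodEFin; apply: eq_bigr => j _; rewrite fineK.
rewrite -EFinM; apply: (@integral_cubes_le _ _ (fun y => \prod_(j < N) f j (l j y))%R H) => //.
- move=> q; apply: prodr_ge0 => j _; case: (p j) => [r||].
  + exact: powR_ge0.
  + by rewrite fine_ge0.
  + by rewrite fine_ge0.
- move: aeL => [B [mB B0 sub]]; exists B; split => // y /= h; apply: sub => /= fL.
  apply: h; apply: ler_prod => j _; rewrite f0/=.
  have faj : (f j (l j y) <= a j (floorv (l j y)))%R by rewrite -lee_fin -aE.
  apply: (le_trans faj); case pj : (p j) (p1 j) => [r||]// _; last first.
    by rewrite -lee_fin -aE fineK.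
  have r0 := r_gt0 _ _ pj.
  have kn : floorv (l j y) \in near j (floorv y).
    case: (nearP j (floorv y)) => _ ->.
    apply: (@le_trans _ _ (1 + Kb)%R); last first.
      by apply/ltW/archi_boundP; rewrite addr_ge0.
    rewrite (_ : _ - _ = (y - (floorv y)%:V) *m lin1_mx (l j) - (l j y - (floorv (l j y))%:V))%R.
      rewrite (le_trans (ler_normB _ _))// [leRHS]addrC lerD ?floorv_dist//.
      rewrite (le_trans (HKb _ _))// -[leRHS]mulr1 ler_wpM2l//; exact: floorv_dist.
    by rewrite mulmxBl (mul_rV_lin1 _ y) opprB [RHS]addrC addrA subrK.
  rewrite -[leLHS](powRr1 (a0 _ _)) -(mulfV (lt0r_neq0 r0)) powRrM.
  apply: ge0_ler_powR; rewrite ?nnegrE ?invr_ge0 ?(ltW r0) ?powR_ge0//.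
    by apply: sumr_ge0 => k _; exact: powR_ge0.
  rewrite (bigD1_seq (floorv (l j y)))//=; last by case: (nearP j (floorv y)).
  by rewrite lerDl; apply: sumr_ge0 => k _; exact: powR_ge0.
- move=> s us; apply: (@le_trans _ _ (C * \prod_(j < N) fine (A j))%R).
    by apply: HC => // j; rewrite fine_ge0.
  by rewrite ler_wpM2r ?lerDl//; apply: prodr_ge0 => j _; rewrite fine_ge0.
Qed.

End sufficiency_integral.

(** * Necessity *)

Section necessity_lemmas.
Context {R : realType}.

Lemma powR_growth (a b C : R) :
  (forall T : nat, (0 < T)%N -> T%:R `^ a <= C * T%:R `^ b) -> a <= b.
Proof.
move=> H; rewrite leNgt; apply/negP => ba.
have ab0 : 0 < a - b by rewrite subr_gt0.
have H' (T : nat) : (0 < T)%N -> T%:R `^ (a - b) <= C.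
  move=> T0; have T0' : 0 < T%:R :> R by rewrite ltr0n.
  rewrite powRB; last by rewrite (gt_eqF T0') implybT.
  by rewrite ler_pdivrMr ?powR_gt0// H.
have C0 : 0 <= C by apply: le_trans (H' 1%N isT); rewrite powR_ge0.
pose x := C `^ (a - b)^-1.
have := H' (Num.bound x).+1 isT; apply/negP; rewrite -ltNge.
have CE : C = x `^ (a - b) by rewrite /x -powRrM mulVf ?gt_eqF// powRr1.
rewrite {1}CE; apply: gt0_ltr_powR; rewrite ?nnegrE ?powR_ge0//.
by rewrite (lt_trans (archi_boundP _)) ?powR_ge0// ltr_nat.
Qed.

(** Every local supremum is at most 1 and vanishes off [s], so the sum of powers is at most
    [size s]; for [p = +oo] the exponent is 0 and the bound is 1. *)
Lemma amalgam_norm_le_count d (p : \bar R) (f : 'rV[R]_d -> R) (s : seq 'rV[int]_d) :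
  (1 <= p)%E -> (forall x, 0 <= f x <= 1) ->
  (forall k x, k \notin s -> Qset k x -> f x = 0) ->
  (amalgam_norm p f <= ((size s)%:R `^ inv_exponent p)%:E)%E.
Proof.
move=> p1 f01 fs.
have L1 k : (Linfty_Q f k <= 1)%E.
  rewrite Linfty_QE; apply/ess_supP; apply: aeW => x /=.
  rewrite patchE; case: ifP => _; last by rewrite /= normr0 lee_fin ler01.
  by rewrite /= lee_fin; case/andP: (f01 x) => *; rewrite ger0_norm.
have L0 k : k \notin s -> Linfty_Q f k = 0%E.
  move=> ks; apply/eqP; rewrite eq_le Linfty_Q_ge0 andbT Linfty_QE.
  apply/ess_supP; apply: aeW => x /=; rewrite patchE; case: ifPn => [|_]; last by rewrite /= normr0.
  by rewrite inE => /(fs k x ks) fx0; rewrite /= fx0 normr0.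
case: p p1 => [r||]//= p1; last first.
  by rewrite powRr0; apply: ge_ereal_sup => _ [k _ <-].
have r0 : 0 < r by rewrite lee_fin in p1; exact: lt_le_trans p1.
rewrite -poweR_EFin; apply: gt0_ler_poweR.
- by rewrite invr_ge0 ltW.
- by rewrite in_itv/= leey andbT; apply: esum_ge0 => k _; exact: poweR_ge0.
- by rewrite in_itv/= leey andbT lee_fin.
have pw0 k : (0 <= Linfty_Q f k `^ r)%E by exact: poweR_ge0.
rewrite (esumID [set` s])// !setTI [X in (_ + X)%E]esum1 ?adde0; last first.
  by move=> k /= /negP ks; rewrite L0// poweR0r// gt_eqF.
rewrite esum_fset//; last exact: finite_seq.
rewrite (_ : [set` s] = [set` undup s]); last by apply/seteqP; split => k /=; rewrite mem_undup.
rewrite -fsbig_seq ?undup_uniq//.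
apply: (@le_trans _ _ (\sum_(k <- undup s) 1)%E).
  apply: lee_sum => k _; rewrite -[leRHS](poweR1r r).
  apply: gt0_ler_poweR => //; first exact: ltW.
    by rewrite in_itv/= leey andbT Linfty_Q_ge0.
  by rewrite in_itv/= leey andbT.
rewrite (eq_bigr (fun=> 1%:E))// sumEFin lee_fin big_const_seq count_predT iter_addr_0.
by rewrite ler_nat size_undup.
Qed.

(** [v *m W] depends on [v] only through [\rank W] coordinates of size [O(T)]. Rounding them leaves
    [O(T ^ \rank W)] centres, each with boundedly many lattice points nearby. *)
Lemma lattice_count n m (W : 'M[R]_(n, m)) (rho : R) : exists K : nat,
  forall T : nat, (0 < T)%N -> exists s : seq 'rV[int]_m,
    (size s <= K * T ^ \rank W)%N /\
    forall (v : 'rV[R]_n) k, `|v| <= T%:R -> `|k%:V - v *m W| <= rho -> k \in s.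
Proof.
pose B := row_base W.
have /submxP[W' WE] : (W <= B)%MS by rewrite eq_row_base.
have [c c0 Hc] := mulmx_norm_bound W'; have [b b0 Hb] := mulmx_norm_bound B.
(* [c1 * T] absorbs [c * T + 1], a bound for the rounded coordinates, as [T >= 1]; [t2] covers [rho]
   and the rounding error [b]. *)
pose c1 := (Num.bound c).+1; pose t2 := Num.bound (`|rho| + b).
exists ((c1 * 2 + 2) ^ \rank W * t2.*2.+2 ^ m)%N => T T0.
have [q [_ qs qP]] := near_int (c1 * T)%N (0 : 'rV[R]_(\rank W)).
pose near x := sval (cid (near_int t2 (x : 'rV[R]_m))).
have nearP x : (size (near x) <= t2.*2.+2 ^ m)%N /\
    forall k, (k \in near x) = (`|k%:V - x| <= t2%:R).
  by rewrite /near; case: cid => s /= [].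
exists (flatten [seq near (u%:V *m B) | u <- q]); split.
  rewrite size_flatten sumnE /shape -map_comp big_map.
  apply: (@leq_trans (\sum_(u <- q) t2.*2.+2 ^ m)%N).
    by apply: leq_sum => u _ /=; case: (nearP (u%:V *m B)).
  rewrite big_const_seq count_predT iter_addn_0 mulnC mulnAC leq_mul2r.
  apply/orP; right; apply: (leq_trans qs); rewrite -expnMn.
  have [->|r0] := posnP (\rank W); first by rewrite !expn0.
  by rewrite leq_exp2r// -muln2; nia.
move=> v k vT kv; apply/flattenP; exists (near ((floorv (v *m W'))%:V *m B)).
  apply: map_f; rewrite qP subr0.
  rewrite (_ : _%:V = (v *m W') - (v *m W' - (floorv (v *m W'))%:V)); last first.
    by rewrite opprB addrC subrK.
  rewrite (le_trans (ler_normB _ _))// (@le_trans _ _ (c * T%:R + 1))//.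
    rewrite lerD// ?floorv_dist// (le_trans (Hc _))// ler_wpM2l//.
  rewrite natrM /c1 -addn1 natrD mulrDl mul1r lerD//.
    by rewrite ler_wpM2r// ltW// archi_boundP.
  by rewrite ler1n.
case: (nearP ((floorv (v *m W'))%:V *m B)) => _ ->.
apply: (@le_trans _ _ (`|rho| + b)); last by rewrite ltW// archi_boundP// addr_ge0.
rewrite (_ : _ - _ = (k%:V - v *m W) + (v *m W' - (floorv (v *m W'))%:V) *m B); last first.
  by rewrite mulmxBl -mulmxA -WE addrA subrK.
rewrite (le_trans (ler_normD _ _))// lerD//; first by rewrite (le_trans kv)// ler_norm.
by rewrite (le_trans (Hb _))// -[leRHS]mulr1 ler_wpM2l//; exact: floorv_dist.
Qed.

End necessity_lemmas.

(** * Testing the inequality on a grid of cubes *)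

Section necessity.
Context {R : realType}.

Lemma lee_prod N (x y : 'I_N -> \bar R) : (forall j, 0 <= x j <= y j)%E ->
  (0 <= \prod_j x j <= \prod_j y j)%E.
Proof.
move=> xy; apply: (big_rec2 (fun a b => 0 <= a <= b)%E); first by rewrite lexx lee01.
move=> j a b _ /andP[a0 ab]; have /andP[x0 xyj] := xy j.
by rewrite mule_ge0//= lee_pmul.
Qed.

Lemma powR_sum N (x : R) (a : 'I_N -> R) : 0 < x ->
  x `^ (\sum_j a j) = \prod_j x `^ a j.
Proof.
move=> x0; apply: (big_rec2 (fun s t => x `^ s = t)); first by rewrite powRr0.
by move=> j s t _ <-; rewrite powRD// (gt_eqF x0) implybT.
Qed.

Lemma box_measurable n (c c' : 'rV[R]_n) :
  measurable ([set y | forall i, c ord0 i <= (y : 'rV[R]_n) ord0 i <= c' ord0 i] :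
    set (borel_rV n)).
Proof.
rewrite (_ : [set _ | _] = [set y : 'rV[R]_n | forall i,
    (`[c ord0 i, c' ord0 i]%classic : set (measurableTypeR R)) (y ord0 i)]).
  apply: (@measurable_box R n (fun i => `[c ord0 i, c' ord0 i]%classic)) => i.
  exact: measurable_itv.
by apply/seteqP; split => y h i; have := h i; rewrite /= in_itv.
Qed.

Lemma unit_box_dist n (c y : 'rV[R]_n) : unit_box c y -> `|y - c| <= 1.
Proof.
move=> cy; apply/rV_norm_leP => // i; have := cy i; rewrite /= in_itv/= => h.
by rewrite !mxE ler_norml; apply/andP; split; lra.
Qed.

Lemma unit_box_meet n (c c' y : 'rV[R]_n) : unit_box c y -> unit_box c' y -> `|c - c'| <= 1.
Proof.
move=> cy cy'; apply/rV_norm_leP => // i; have := cy i; have := cy' i.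
rewrite /= !in_itv/= => h h'.
by rewrite !mxE ler_norml; apply/andP; split; lra.
Qed.

Definition grid_point r T (e : {ffun 'I_r -> 'I_T}) : 'rV[R]_r := \row_i (e i)%:R.

Lemma grid_point_norm r T (e : {ffun 'I_r -> 'I_T}) : `|grid_point e| <= T%:R.
Proof.
by apply/rV_norm_leP => // i; rewrite mxE ger0_norm// ler_nat ltnW.
Qed.

Lemma grid_point_sep r T (e e' : {ffun 'I_r -> 'I_T}) : e != e' ->
  1 <= `|grid_point e - grid_point e'|.
Proof.
move=> ee'; have [i ei] : exists i, e i != e' i.
  apply/existsP; apply: contraNT ee'; rewrite negb_exists => /forallP h.
  by apply/eqP/ffunP => i; apply/eqP; rewrite -[_ == _]negbK.
apply: le_trans (coord_le_norm _ i).
rewrite !mxE -[X in X - _]/((e i)%:~R) -[X in _ - X]/((e' i)%:~R).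
rewrite -intrB -intr_norm -[leLHS]/(1%:~R) ler_int -gtz0_ge1 normr_gt0 subr_eq0.
by apply: contra ei => /eqP[] /val_inj ->.
Qed.

Lemma integral_bound_feasible N d (dd : 'I_N -> nat)
    (l : forall j, 'Hom('rV[R]_d, 'rV[R]_(dd j))) (p : 'I_N -> \bar R) (C : R) :
  (forall j, 1 <= p j)%E ->
  (forall f : (forall j : 'I_N, 'rV[R]_(dd j) -> R),
     (forall j, measurable_fun [set: lebesgue_rVType R (dd j)]
       (f j : lebesgue_rVType R (dd j) -> R)) ->
     (forall j x, 0 <= f j x) ->
     (\int[lebesgue_rV R d]_y (\prod_(j < N) f j (l j y))%:E
        <= C%:E * \prod_(j < N) amalgam_norm (p j) (f j))%E) ->
  feasible (fun j => lin1_mx (l j)) (fun j => inv_exponent (p j)).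
Proof.
move=> p1 bound V; pose r := \rank V; pose B := row_base V.
have [Kq Kq0 HKq] := mulmx_norm_bound (pinvmx B).
(* Distinct grid points are at least 1 apart and [B] shrinks norms by at most the factor [Kq], so
   scaling by [Kq + 1] makes the unit boxes at their images disjoint. *)
pose L j := lin1_mx (l j); pose W := (Kq + 1) *: B.
have [Kb Kb0 HKb] := mulmx_norm_bound_fam L.
have D0 : Kq + 1 != 0 by rewrite gt_eqF// ltr_wpDl.
have rankW j : \rank (W *m L j) = \rank (V *m L j).
  rewrite -scalemxAl mxrank_scale_nz//.
  have e : (B *m L j :=: V *m L j)%MS by apply/eqmxMr/eq_row_base.
  by rewrite e.
(* If [Qset k] meets the [Kb]-neighbourhood of a point, then [k] is within [Kb + sqrt (dd j)] of
   that point. *)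
have /choice[K HK] j := lattice_count (W *m L j) (Kb + Num.sqrt (dd j)%:R).
pose s j := inv_exponent (p j).
have s0 j : 0 <= s j by case/andP: (inv_exponent01 (p1 j)).
(* [C] may be negative, hence the maximum with 0. *)
apply: (@powR_growth _ _ _ (Num.max C 0 * \prod_j (K j)%:R `^ s j)) => T T0.
pose G := {ffun 'I_r -> 'I_T}.
pose g (e : G) := grid_point e *m W.
have disj (e e' : G) y : unit_box (g e) y -> unit_box (g e') y -> e = e'.
  move=> ey ey'; apply/eqP; apply: contraT => /grid_point_sep sep.
  have := unit_box_meet ey ey'; rewrite /g -mulmxBl /W -scalemxAr normrZ.
  rewrite ger0_norm ?addr_ge0//; set w := _ - _ in sep *; set X := `|_| => XD.
  have : 1 <= Kq * X.
    apply: (le_trans sep); rewrite -[w in leLHS](mulmxKp (row_base_free V)).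
    exact: HKq.
  have X0 : 0 <= X by exact: normr_ge0.
  rewrite mulrDl mul1r in XD => KX; have Xe : X = 0 by lra.
  by move: KX; rewrite Xe mulr0; lra.
(* A unit box is within 1 of its corner and [l j] expands norms by at most [Kb], so [l j] maps all
   the boxes into [S j]. *)
pose S j : set 'rV[R]_(dd j) := [set x | exists e : G, `|x - g e *m L j| <= Kb].
have mS j : measurable (S j : set (lebesgue_rVType R (dd j))).
  apply: borel_lebesgue_measurable.
  rewrite (_ : S j = \bigcup_(e in [set: G]) [set y : 'rV[R]_(dd j) | forall i,
     (g e *m L j - const_mx Kb) ord0 i <= y ord0 i <= (g e *m L j + const_mx Kb) ord0 i]).
    apply: fin_bigcup_measurable; first exact: finite_finset.
    by move=> e _; exact: box_measurable.
  apply/seteqP; split=> x /=.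
    move=> [e /rV_norm_leP h]; exists e => //= i; have := h Kb0 i.
    by rewrite !mxE ler_norml => ?; apply/andP; split; lra.
  move=> [e _ h]; exists e; apply/rV_norm_leP => // i; have := h i.
  by rewrite !mxE ler_norml => ?; apply/andP; split; lra.
pose f j (x : 'rV[R]_(dd j)) : R := \1_(S j) x.
have f01 j x : 0 <= f j x <= 1 by rewrite /f indicE; case: (_ \in _); rewrite ?lexx ?ler01.
have f0 j x : 0 <= f j x by case/andP: (f01 j x).
have := bound f (fun j => measurable_indic (mS j)) f0.
have amalg j : (0 <= amalgam_norm (p j) (f j) <=
    ((K j)%:R `^ s j * T%:R `^ (s j * (\rank (V *m L j))%:R))%:E)%E.
  rewrite amalgam_norm_ge0/=; have [q [qs qP]] := HK j T T0.
  apply: (@le_trans _ _ ((size q)%:R `^ s j)%:E).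
    apply: amalgam_norm_le_count => // k x kq Qk; rewrite /f indicE memNset// => -[e xe].
    move/negP: kq; apply; apply: (qP (grid_point e)); first exact: grid_point_norm.
    rewrite mulmxA -/(g e) (_ : _ - _ = (x - g e *m L j) - (x - k%:V)); last first.
      by rewrite opprB [RHS]addrC addrA subrK.
    by rewrite (le_trans (ler_normB _ _))// lerD// (le_trans (norm_le_enorm _)).
  rewrite lee_fin; apply: (@le_trans _ _ ((K j * T ^ \rank (V *m L j))%:R `^ s j)).
    by apply: ge0_ler_powR; rewrite ?nnegrE// ler_nat -rankW.
  by rewrite natrM powRM// natrX -powR_mulrn// -powRrM mulrC [s j * _]mulrC mulrC.
move=> le1.
have {}le1 := le_trans le1 (lee_wpmul2r (proj1 (andP (lee_prod amalg)))
  (_ : C%:E <= (Num.max C 0)%:E)%E).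
have {le1} := le_trans (le1 _)
  (lee_wpmul2l (_ : 0 <= (Num.max C 0)%:E)%E (proj2 (andP (lee_prod amalg)))).
rewrite !lee_fin !le_max !lexx orbT => /(_ isT isT).
rewrite prodEFin -EFinM big_split/= -powR_sum ?ltr0n// mulrA => le1.
rewrite -lee_fin; apply: le_trans le1.
(* The boxes are disjoint, so the sum of their indicators is at most 1, and where it is 1 every
   factor of the product is 1. *)
apply: (@le_trans _ _ (\int[lebesgue_rV R d]_y
  \sum_(e : G) (\1_(unit_box (g e)) y)%:E)%E); last first.
  apply: le_integral_ge0 => y; first by apply: sume_ge0 => e _; rewrite lee_fin.
  rewrite sumEFin lee_fin; have [e ey|none] := pickP (fun e : G => y \in unit_box (g e)).
    rewrite (bigD1 e)//= big1 ?addr0 => [|e' ee']; last first.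
      rewrite indicE memNset// => e'y; move/negP: ee'; apply; apply/eqP.
      by apply: disj e'y _; exact: set_mem.
    rewrite indicE ey big1// => j _; rewrite /f indicE mem_set//; exists e.
    rewrite -mul_rV_lin1 -mulmxBl (le_trans (HKb _ _))// -[leRHS]mulr1 ler_wpM2l//.
    by apply: unit_box_dist; exact: set_mem.
  rewrite big1 ?prodr_ge0// => e _; by rewrite indicE none.
have mg (e : G) : measurable_fun [set: lebesgue_rVType R d]
    (fun y : lebesgue_rVType R d => (\1_(unit_box (g e)) y : R)%:E).
  apply/measurable_EFinP; apply: measurable_indic.
  exact: borel_lebesgue_measurable (measurable_unit_box _).
rewrite (ge0_integral_sum _ measurableT mg); last first.
  by move=> e y _; rewrite lee_fin.
rewrite (eq_bigr (fun=> 1%:E)) => [|e _]; last first.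
  rewrite integral_indic//; last exact: borel_lebesgue_measurable (measurable_unit_box _).
  by rewrite setIT; exact: lebesgue_unit_box.
rewrite sumEFin sumr_const card_ffun !card_ord lee_fin powR_mulrn//.
by rewrite -natrX.
Qed.

End necessity.

Local Open Scope ereal_scope.

Theorem theorem2p5 (R : realType) (N d : nat) (dd : 'I_N -> nat)
    (l : forall j : 'I_N, 'Hom('rV[R]_d, 'rV[R]_(dd j)))
    (l_surj : forall j : 'I_N, limg (l j) = fullv)
    (p : 'I_N -> \bar R) (p_ge1 : forall j : 'I_N, 1 <= p j) :
  (exists C : R,
     forall f : (forall j : 'I_N, 'rV[R]_(dd j) -> R),
       (forall j : 'I_N,
          measurable_fun [set: lebesgue_rVType R (dd j)]
            (f j : lebesgue_rVType R (dd j) -> R)) ->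
       (forall (j : 'I_N) (x : 'rV[R]_(dd j)), (0 <= f j x)%R) ->
       \int[lebesgue_rV R d]_y (\prod_(j < N) f j (l j y))%:E
         <= C%:E * \prod_(j < N) amalgam_norm (p j) (f j))
  <->
  (forall V : {vspace 'rV[R]_d},
     (\dim V)%:R%:E <= \sum_(j < N) (p j)^-1 * (\dim (l j @: V)%VS)%:R%:E).
Proof.
split=> [[C bound]|cond].
  apply/(dim_conditionP l p_ge1); exact: integral_bound_feasible bound.
have [C HC] := feasible_integral_bound l_surj p_ge1 ((dim_conditionP l p_ge1).1 cond).
by exists C => f _ f0; exact: HC.
Qed.
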